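(* Let $\mathbb{F}$ be a finite field and let $A\in \mathbb{F}^{n\times n}$ be a generic matrix, and suppose a Frobenius normal form of $A$ is given. One can preprocess $A$ in $\widetilde{O}(n^2)$ time so that the following queries are supported: given $S,T\subseteq \{1,\ldots,n\}$ and an integer $h\in [1,n]$, compute the $S\times T$ submatrices of the matrix powers $A^1,\ldots,A^h$. The query time is $\widetilde{O}(n^{\omega(s,1-\alpha,t)+\alpha})$, where $|S|=\lfloor n^s\rfloor$, $|T|=\lfloor n^t\rfloor$ and $h=\lfloor n^\alpha\rfloor$.
   Context: A matrix $A\in\mathbb{F}^{n\times n}$ is called generic if its characteristic polynomial $p_A(t)=\det(tI-A)$ equals its minimal polynomial. For generic $A$ with $p_A(t)=t^n+c_{n-1}t^{n-1}+\dots+c_0$, a Frobenius normal form (FNF) of $A$ is a factorization $A=U\cdot C\cdot U^{-1}$ with $U\in\mathbb{F}^{n\times n}$ invertible and $C$ the companion matrix of $p_A$ (the matrix with ones on the subdiagonal, last column $(-c_0,\ldots,-c_{n-1})^T$, and zeros elsewhere); ''given'' means $U$, $C$ and $U^{-1}$ are given explicitly. Time is measured in field operations. $\omega(a,b,c)$ denotes the exponent such that an $n^a\times n^b$ matrix can be multiplied by an $n^b\times n^c$ matrix in $O(n^{\omega(a,b,c)})$ time. $\widetilde{O}$ hides polylogarithmic factors in $n$. *)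

(* Defs.v *)
From HB Require Import structures.
From mathcomp Require Import all_boot all_order all_algebra.
From mathcomp Require Import all_classical all_reals all_analysis.

Set Implicit Arguments.
Unset Strict Implicit.
Unset Printing Implicit Defensive.

Import Order.TTheory GRing.Theory Num.Theory.
Import numFieldNormedType.Exports.

Local Open Scope classical_set_scope.
Local Open Scope ring_scope.

(* Time is measured in field operations, so algorithms are straight-line      *)
(* programs over F.  Field elements are opaque: a program can only copy them  *)
(* (for free) and combine them with the operations below (at unit cost).      *)
(* The inputs are indexed by a type I, the outputs by a type O.               *)

(* [inl i] is the input with index i, [inr k] the result of instruction k.    *)
Definition operand (I : Type) : Type := (I + nat)%type.

(* Division is that of MathComp, with x / 0 = 0.  As F is finite, x / y is    *)
(* then x * y ^+ (#|F| - 2) (for #|F| > 2), so this convention changes costs  *)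
(* by a constant factor only.                                                 *)
Inductive instr (F I : Type) : Type :=
| Const of F
| Add of operand I & operand I
| Sub of operand I & operand I
| Mul of operand I & operand I
| Div of operand I & operand I.

Record slp (F I O : Type) : Type := Slp {
  slp_code : seq (instr F I);
  slp_out  : O -> operand I
}.

Section Semantics.
Variables (F : fieldType) (I O : Type) (x : I -> F).

(* A reference to an instruction that has not been executed yet reads 0. *)
Definition read (mem : seq F) (o : operand I) : F :=
  match o with inl i => x i | inr k => mem`_k end.

Definition exec_instr (mem : seq F) (c : instr F I) : F :=
  match c with
  | Const a => a
  | Add o1 o2 => read mem o1 + read mem o2
  | Sub o1 o2 => read mem o1 - read mem o2
  | Mul o1 o2 => read mem o1 * read mem o2
  | Div o1 o2 => read mem o1 / read mem o2
  end.

Definition exec (code : seq (instr F I)) : seq F :=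
  foldl (fun mem c => rcons mem (exec_instr mem c)) [::] code.

Definition run (P : slp F I O) (o : O) : F :=
  read (exec (slp_code P)) (slp_out P o).
End Semantics.

Definition cost (F I O : Type) (P : slp F I O) : nat := size (slp_code P).

Section Asymptotics.
Variable R : realType.
Implicit Types f g : nat -> R.

Definition soft_O f g : Prop :=
  exists c : nat, f =O_\oo (fun n => g n * ln n%:R ^+ c).

Definition floor_pow (n : nat) (a : R) : nat := Num.truncn (n%:R `^ a).
End Asymptotics.

Section RectangularMultiplication.
Variables (R : realType) (F : fieldType).

Definition mulmx_data (p q r : nat) (X : 'M[F]_(p, q)) (Y : 'M[F]_(q, r))
    (l : 'I_p * 'I_q + 'I_q * 'I_r) : F :=
  match l with inl ij => X ij.1 ij.2 | inr jk => Y jk.1 jk.2 end.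

(* w is admissible as the exponent omega(a, b, c) over F: an n^a x n^b matrix *)
(* can be multiplied by an n^b x n^c matrix in O(n^w) operations.  Taking w   *)
(* as a parameter, rather than an infimum which need not be attained, makes   *)
(* this bound hold without an additional n^o(1).                              *)
Definition mulmx_exponent (a b c w : R) : Prop :=
  exists M : forall n, slp F ('I_(floor_pow n a) * 'I_(floor_pow n b) +
                              'I_(floor_pow n b) * 'I_(floor_pow n c))
                             ('I_(floor_pow n a) * 'I_(floor_pow n c)),
    (forall n (X : 'M[F]_(floor_pow n a, floor_pow n b))
              (Y : 'M[F]_(floor_pow n b, floor_pow n c)) i k,
        run (mulmx_data X Y) (M n) (i, k) = (X *m Y) i k) /\
    (fun n => (cost (M n))%:R : R) =O_\oo (fun n => n%:R `^ w : R).
End RectangularMultiplication.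

Section FrobeniusNormalForm.
Variables (F : fieldType) (n : nat).
Implicit Types A U C V : 'M[F]_n.+1.

Definition generic A : Prop := mxminpoly A = char_poly A.

(* The [companionmx] of MathComp is the transpose of this one. *)
Definition companion (p : {poly F}) : 'M[F]_n.+1 :=
  \matrix_(i, j) if j == n :> nat then - p`_i else (i == j.+1 :> nat)%:R.

Definition is_FNF A U C V : Prop :=
  [/\ U \in unitmx, V = invmx U, C = companion (char_poly A)
    & A = U *m C *m V].

(* Addresses of the entries of A, U, C and U^-1. *)
Inductive FNF_index : Type :=
| entryA of 'I_n.+1 & 'I_n.+1
| entryU of 'I_n.+1 & 'I_n.+1
| entryC of 'I_n.+1 & 'I_n.+1
| entryV of 'I_n.+1 & 'I_n.+1.

Definition FNF_data A U C V (l : FNF_index) : F :=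
  match l with
  | entryA i j => A i j
  | entryU i j => U i j
  | entryC i j => C i j
  | entryV i j => V i j
  end.
End FrobeniusNormalForm.

(* Main.v *)
(* Let u be the first column of U and w i l = (A^l u)_i.  As A U = U C with C  *)
(* the companion matrix, the l-th column of A^k U is A^(k+l) u, so that        *)
(*   (A^k)_{ij} = \sum_(l < N) w i (k + l) * (U^-1)_{lj}      for k <= N.      *)
(* For fixed i, the sequence w i is linearly recurrent with characteristic    *)
(* polynomial p_A: its first N terms are the i-th row of U, and the next N     *)
(* come from two polynomial products, with p_A reversed and with the inverse  *)
(* power series of the latter.  This is the preprocessing.                    *)
(* Writing l = h b + r with r < h, the sum over l is the coefficient of degree *)
(* h - 1 + k in the product of an |S| x (N / h) and an (N / h) x |T| matrix of *)
(* polynomials of degree < 2 h, which is computed by evaluation at O(h)       *)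
(* points, matrix products over F, and interpolation.                         *)
(* F may be too small to have so many points.  In an extension L of degree    *)
(* m = O(log h), the additive FFT evaluates at #|F|^m points: the linearized   *)
(* polynomials s_(i+1) = s_i^#|F| - s_i(b)^(#|F|-1) s_i are sparse, and modulo *)
(* s_(i+1) - s_(i+1)(x) a polynomial splits into its residues modulo          *)
(* s_i - s_i(x + c b), where c ranges over F.                                 *)
(* The entrywise work is absorbed in the cost of the matrix products, because *)
(* any program multiplying matrices reads all its inputs and computes each    *)
(* output by its own instruction.                                             *)
Require Import Defs.
From HB Require Import structures.
From mathcomp Require Import all_boot all_order all_algebra.
From mathcomp Require Import all_fingroup all_solvable all_field.
From mathcomp Require Import all_classical all_reals all_analysis.
From mathcomp Require Import zify ring lra.

Set Implicit Arguments.
Unset Strict Implicit.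
Unset Printing Implicit Defensive.

Import Order.TTheory GRing.Theory Num.Theory.
Import numFieldNormedType.Exports.

Local Open Scope classical_set_scope.
Local Open Scope ring_scope.

(** * Cost of computing functions from known functions *)

Section Reach.
Variables (X : Type) (step : set X -> X -> Prop).
Implicit Types K Z : set X.

(* [reach K c Z]: from the elements of K, those of Z are obtained by c steps. *)
(* The set K0 makes [reach] monotone in K for an arbitrary [step].            *)
Inductive reach : set X -> nat -> set X -> Prop :=
| reach_sub K c Z of Z `<=` K : reach K c Z
| reach_step K0 K g of K0 `<=` K & step K0 g : reach K 1 (K `|` [set g])
| reach_trans K c Z c' Z' of reach K c Z & reach Z c' Z' : reach K (c + c') Z'.

Lemma reach_le K c c' Z : (c <= c')%N -> reach K c Z -> reach K c' Z.
Proof.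
move=> /subnKC <- r; apply: reach_trans r _.
exact: reach_sub.
Qed.

Lemma reach_sub_r K c Z Z' : Z' `<=` Z -> reach K c Z -> reach K c Z'.
Proof.
move=> s r; rewrite -[c]addn0; apply: reach_trans r _.
exact: reach_sub.
Qed.

Lemma reach_frame K c Z Y : reach K c Z -> reach (K `|` Y) c (Z `|` Y).
Proof.
elim=> {K c Z} [K c Z s|K0 K g s sg|K c Z c' Z' _ r1 _ r2].
- by apply: reach_sub; apply: setSU.
- by rewrite setUAC; apply: reach_step sg => f /s; left.
- exact: reach_trans r1 r2.
Qed.

Lemma reach_keep K c Z : reach K c Z -> reach K c (K `|` Z).
Proof. by move=> /(reach_frame K); rewrite setUid setUC. Qed.

Lemma reach_seq K c c' Z Z' :
  reach K c Z -> reach (K `|` Z) c' Z' -> reach K (c + c') Z'.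
Proof. by move=> /reach_keep; apply: reach_trans. Qed.

Lemma reach_mono K K' c Z : K `<=` K' -> reach K c Z -> reach K' c Z.
Proof.
move=> s /(reach_frame K'); rewrite (setUidr s).
by apply: reach_sub_r; apply: subsetUl.
Qed.

Lemma reach_setU K c c' Z Z' :
  reach K c Z -> reach K c' Z' -> reach K (c + c') (Z `|` Z').
Proof.
move=> r r'; apply: reach_trans (reach_keep r) _.
apply: (@reach_sub_r _ _ (K `|` Z `|` Z')).
  by apply: setSU; apply: subsetUr.
by apply: reach_keep; apply: reach_mono r'; apply: subsetUl.
Qed.

Lemma reach_step1 K g : step K g -> reach K 1 [set g].
Proof.
by move=> /(reach_step (@subset_refl _ K)); apply: reach_sub_r; apply: subsetUr.
Qed.

Lemma reach_bigcup (T : eqType) (r : seq T) K c (Z : T -> set X) :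
  (forall t, t \in r -> reach K c (Z t)) ->
  reach K (size r * c) (\bigcup_(t in [set` r]) Z t).
Proof.
elim: r => [|t r IH] rZ; first by apply: reach_sub => x [].
rewrite mulSn.
apply: (@reach_sub_r _ _ (Z t `|` \bigcup_(t in [set` r]) Z t)).
  move=> x [u /=]; rewrite inE => /orP[/eqP->|ur] Zx; [by left|right].
  by exists u.
by apply: reach_setU; [apply: rZ; rewrite mem_head
  | apply: IH => u ur; apply: rZ; rewrite inE ur orbT].
Qed.

Lemma reach_fin (T : finType) K c (Z : T -> set X) :
  (forall t, reach K c (Z t)) -> reach K (#|T| * c) (\bigcup_t Z t).
Proof.
move=> rZ; rewrite cardE; apply: reach_sub_r (reach_bigcup (fun t _ => rZ t)).
by move=> x [t _ Zx]; exists t => //=; rewrite mem_enum.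
Qed.

Lemma reach_iter K c n (Z : nat -> set X) :
  (forall k, (k < n)%N -> reach (K `|` \bigcup_(j in `I_k) Z j) c (Z k)) ->
  reach K (n * c) (\bigcup_(j in `I_n) Z j).
Proof.
elim: n => [|n IH] rZ; first by apply: reach_sub => x [].
rewrite mulSn addnC; apply: reach_seq (IH _) _ => [k kn|].
  by apply: rZ; apply: ltnW.
apply: reach_sub_r (reach_keep (rZ n (ltnSn n))).
move=> x [j /=]; rewrite ltnS leq_eqVlt => /orP[/eqP->|jn] Zx; first by right.
by left; right; exists j.
Qed.
End Reach.

Section ArithmeticReach.
Variables (E : Type) (F : fieldType).
Implicit Types (K : set (E -> F)) (f g : E -> F).

Definition arith_step K g : Prop :=
  (exists a, g = cst a) \/
  exists f1 f2, [/\ K f1, K f2 &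
    [\/ g = f1 \+ f2, g = f1 \- f2, g = f1 \* f2
      | g = fun e => f1 e / f2 e]].

Definition areach := reach arith_step.

Lemma areach_cst K a : areach K 1 [set cst a].
Proof. by apply: reach_step1; left; exists a. Qed.

Lemma areach_add K f g : K f -> K g -> areach K 1 [set f \+ g].
Proof.
move=> kf kg; apply: reach_step1.
by right; exists f, g; split=> //; apply: Or41.
Qed.

Lemma areach_sub K f g : K f -> K g -> areach K 1 [set f \- g].
Proof.
move=> kf kg; apply: reach_step1.
by right; exists f, g; split=> //; apply: Or42.
Qed.

Lemma areach_mul K f g : K f -> K g -> areach K 1 [set f \* g].
Proof.
move=> kf kg; apply: reach_step1.
by right; exists f, g; split=> //; apply: Or43.
Qed.
End ArithmeticReach.

Section ReachSlp.
Variables (E : Type) (F : fieldType) (I : Type) (x : E -> I -> F).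
Implicit Types (K Z : set (E -> F)) (f g : E -> F) (code : seq (instr F I)).

Lemma exec_cat (y : I -> F) code code' :
  exec y (code ++ code') =
  foldl (fun mem c => rcons mem (exec_instr y mem c)) (exec y code) code'.
Proof. exact: foldl_cat. Qed.

Lemma exec_rcons (y : I -> F) code c :
  exec y (rcons code c) = rcons (exec y code) (exec_instr y (exec y code) c).
Proof. by rewrite -cats1 exec_cat. Qed.

Lemma size_exec (y : I -> F) code : size (exec y code) = size code.
Proof.
by elim/last_ind: code => // code c IH; rewrite exec_rcons !size_rcons IH.
Qed.

(* The bound on k keeps the operand valid when the code is extended. *)
Definition represents code f (o : operand I) : Prop :=
  (if o is inr k then (k < size code)%N else true) /\
  forall e, read (x e) (exec (x e) code) o = f e.

Lemma represents_rcons code c f o :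
  represents code f o -> represents (rcons code c) f o.
Proof.
case: o => [i|k] [lk h]; split=> // [|e].
  by rewrite size_rcons ltnW.
by rewrite exec_rcons /= nth_rcons size_exec lk; apply: h.
Qed.

Lemma reach_code K c Z : areach K c Z -> forall code,
    (forall f, K f -> exists o, represents code f o) ->
  exists code', (size code' <= size code + c)%N /\
    forall f, Z f -> exists o, represents code' f o.
Proof.
elim=> {K c Z} [K c Z s|K0 K g s sg|K c Z c' Z' _ IH1 _ IH2] code hK.
- exists code; rewrite leq_addr; split=> // f /s; exact: hK.
- have new (i : instr F I) :
    (forall e, exec_instr (x e) (exec (x e) code) i = g e) ->
    exists code', (size code' <= size code + 1)%N /\
      forall f, (K `|` [set g]) f -> exists o, represents code' f o.
    move=> ig; exists (rcons code i); rewrite size_rcons addn1; split=> // f.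
    case=> [/hK[p hp]| ->]; first by exists p; apply: represents_rcons.
    exists (inr (size code)); split; first by rewrite size_rcons.
    by move=> e /=; rewrite exec_rcons nth_rcons size_exec ltnn eqxx.
  case: sg => [[a ga]|[f1 [f2 [/s/hK[p1 [_ h1]] /s/hK[p2 [_ h2]] d]]]].
    by apply: (new (Const I a)) => e; rewrite ga.
  by case: d => gE; [apply: (new (Add F p1 p2)) | apply: (new (Defs.Sub F p1 p2))
    | apply: (new (Mul F p1 p2)) | apply: (new (Div F p1 p2))] => e;
    rewrite gE /= h1 h2.
- have [code1 [s1 h1]] := IH1 _ hK; have [code2 [s2 h2]] := IH2 _ h1.
  by exists code2; split=> //; rewrite addnA (leq_trans s2)// leq_add2r.
Qed.

Lemma reach_slp (O : Type) (D : set O) K c Z (f : O -> E -> F) :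
    (forall g, K g -> exists i, forall e, g e = x e i) ->
    areach K c Z -> (forall o, D o -> Z (f o)) ->
  exists P : slp F I O, (cost P <= c)%N /\
    forall o, D o -> forall e, run (x e) P o = f o e.
Proof.
move=> hK /reach_code h hD; have [g Kg|code [sz hZ]] := h [::].
  by have [i gi] := hK _ Kg; exists (inl i); split.
have /choice[out hout] : forall o, exists p : operand I,
    D o -> forall e, read (x e) (exec (x e) code) p = f o e.
  move=> o; have [Do|nDo] := pselect (D o); last by exists (inr 0%N).
  by have [p [_ hp]] := hZ _ (hD _ Do); exists p.
by exists (Slp code out); split=> // o Do e; apply: hout.
Qed.

Lemma slp_reach (O : Type) (P : slp F I O) K :
    (forall i, K (fun e => x e i)) ->
  areach K (cost P).+1 (range (fun o e => run (x e) P o)).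
Proof.
move=> hK; case: P => code out; rewrite /cost /run /=.
pose Z code := [set (fun e => read (x e) (exec (x e) code) o) | o in setT].
apply: (@reach_sub_r _ _ _ _ (Z code)) => [g [p _ <-]|]; first by exists (out p).
elim/last_ind: code => [|code c IH].
  apply: reach_sub_r (reach_keep (areach_cst K 0)).
  move=> g [[i|k] _ <-] /=; first by left.
  by right; apply/funext => e; rewrite nth_nil.
rewrite size_rcons -addn1.
apply: reach_trans IH _.
pose g e := exec_instr (x e) (exec (x e) code) c.
apply: (@reach_sub_r _ _ _ _ (Z code `|` [set g])) => [_ [p _ <-]|].
  case: p => [i|k] /=; first by left; exists (inl i).
  have [kc|ck] := eqVneq k (size code).
    right; apply/funext => e.
    by rewrite exec_rcons nth_rcons size_exec kc ltnn eqxx.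
  left; exists (inr k) => //=; apply/funext => e.
  rewrite exec_rcons nth_rcons size_exec (negbTE ck).
  by case: ltnP => // h; rewrite nth_default// size_exec.
apply: (reach_step (@subset_refl _ _)); rewrite /g; 
  case: c {g} => [a|o1 o2|o1 o2|o1 o2|o1 o2] /=.
- by left; exists a.
- right; exists (fun e => read (x e) (exec (x e) code) o1),
    (fun e => read (x e) (exec (x e) code) o2).
  by split; [exists o1|exists o2|apply: Or41].
- right; exists (fun e => read (x e) (exec (x e) code) o1),
    (fun e => read (x e) (exec (x e) code) o2).
  by split; [exists o1|exists o2|apply: Or42].
- right; exists (fun e => read (x e) (exec (x e) code) o1),
    (fun e => read (x e) (exec (x e) code) o2).
  by split; [exists o1|exists o2|apply: Or43].
- right; exists (fun e => read (x e) (exec (x e) code) o1),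
    (fun e => read (x e) (exec (x e) code) o2).
  by split; [exists o1|exists o2|apply: Or44].
Qed.
End ReachSlp.

Definition mulmx_slp (F : fieldType) p q r
    (P : slp F ('I_p * 'I_q + 'I_q * 'I_r) ('I_p * 'I_r)) : Prop :=
  forall (X : 'M[F]_(p, q)) (Y : 'M[F]_(q, r)) i k,
    run (mulmx_data X Y) P (i, k) = (X *m Y) i k.

Section LowerBounds.
Variable F : fieldType.

Definition instr_refs (I : Type) (c : instr F I) : seq (operand I) :=
  match c with
  | Const _ => [::]
  | Add p1 p2 | Defs.Sub p1 p2 | Mul p1 p2 | Div p1 p2 => [:: p1; p2]
  end.

Definition code_refs (I : Type) (code : seq (instr F I)) :=
  flatten [seq instr_refs c | c <- code].

Lemma size_code_refs I (code : seq (instr F I)) :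
  (size (code_refs code) <= 2 * size code)%N.
Proof.
elim: code => //= c code IH; rewrite /code_refs /= size_cat mulnS leq_add//.
by case: c.
Qed.

Lemma exec_agree (I : eqType) (x y : I -> F) code :
  (forall i, inl i \in code_refs code -> x i = y i) ->
  exec x code = exec y code.
Proof.
elim/last_ind: code => // code c IH xy.
have refsE : code_refs (rcons code c) = code_refs code ++ instr_refs c.
  by rewrite /code_refs map_rcons flatten_rcons.
rewrite !exec_rcons IH => [|i ic]; last by apply: xy; rewrite refsE mem_cat ic.
have rE p : p \in instr_refs c -> read x (exec y code) p = read y (exec y code) p.
  by case: p => //= i ic; apply: xy; rewrite refsE mem_cat ic orbT.
congr rcons; case: c {xy refsE} rE => [a|p1 p2|p1 p2|p1 p2|p1 p2] //= rE;
  by rewrite !rE// !inE eqxx ?orbT.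
Qed.

Variables (p q r : nat).
Hypotheses (p_gt0 : (0 < p)%N) (q_gt0 : (0 < q)%N) (r_gt0 : (0 < r)%N).
Variable P : slp F ('I_p * 'I_q + 'I_q * 'I_r) ('I_p * 'I_r).
Hypothesis P_mul : mulmx_slp P.

Let u0 : 'I_q := Ordinal q_gt0.

Lemma mul_delta i u v k :
  run (mulmx_data (delta_mx i u) (delta_mx v k)) P (i, k) = (u == v)%:R.
Proof.
by rewrite P_mul mul_delta_mx_cond mulrb; case: eqP => _; rewrite mxE ?eqxx.
Qed.

Lemma mulmx_out i k : exists2 c, slp_out P (i, k) = inr c & (c < cost P)%N.
Proof.
have h1 := mul_delta i u0 u0 k; rewrite eqxx in h1.
case pE: (slp_out P (i, k)) => [l|c].
  have := P_mul (delta_mx i u0) 0 i k; rewrite mulmx0 mxE /run pE /=.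
  have := P_mul 0 (delta_mx u0 k) i k; rewrite mul0mx mxE /run pE /=.
  move: h1; rewrite /run pE /=; case: l {pE} => l /= -> => [_|] /eqP.
    by rewrite oner_eq0.
  by rewrite oner_eq0.
exists c => //; rewrite ltnNge; apply: contra_eqN h1 => cP.
by rewrite /run pE /= nth_default ?size_exec// eq_sym oner_eq0.
Qed.

Lemma mulmx_cost_out : (p * r <= cost P)%N.
Proof.
have hf i k : exists c : 'I_(cost P), slp_out P (i, k) = inr (val c).
  by have [c cE cP] := mulmx_out i k; exists (Ordinal cP).
have /choice[f fP] : forall t : 'I_p * 'I_r, exists c : 'I_(cost P),
  slp_out P t = inr (val c) by case.
have f_inj : injective f.
  move=> [i k] [i' k'] ff.
  have h1 := mul_delta i u0 u0 k.
  have := P_mul (delta_mx i u0) (delta_mx u0 k) i' k'.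
  move: h1; rewrite /run !fP ff => ->.
  rewrite mul_delta_mx mxE eqxx; case: andP => [[/eqP-> /eqP->]//|_ /eqP].
  by rewrite oner_eq0.
by have := leq_card _ f_inj; rewrite card_prod !card_ord.
Qed.

Lemma mulmx_cost_in : (p * q + q * r <= 2 * cost P)%N.
Proof.
apply: leq_trans (size_code_refs (slp_code P)).
pose s := [seq (inl l : operand _) | l <- enum {: 'I_p * 'I_q + 'I_q * 'I_r}].
have <- : size s = (p * q + q * r)%N.
  by rewrite size_map -cardE card_sum !card_prod !card_ord.
apply: uniq_leq_size => [|_ /mapP[l _ ->]].
  by rewrite map_inj_uniq ?enum_uniq// => l l' [].
apply/negPn/negP => lP.
have same x y o c : slp_out P o = inr c -> (forall l', l' != l -> x l' = y l') ->
    run x P o = run y P o.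
  move=> oc xy; rewrite /run oc (exec_agree (y := y))// => l' l'P.
  by apply: xy; apply: contraNneq lP => <-.
case: l lP same => [[i u]|[u k]] lP same.
- have [c oc _] := mulmx_out i (Ordinal r_gt0).
  have := mul_delta i u u (Ordinal r_gt0).
  rewrite (same _ (mulmx_data 0 (delta_mx u (Ordinal r_gt0))) _ _ oc).
    by rewrite P_mul mul0mx mxE eqxx => /eqP; rewrite eq_sym oner_eq0.
  case=> [[i' u']|//] /= h; rewrite !mxE; case: andP => // -[/eqP e1 /eqP e2].
  by rewrite e1 e2 eqxx in h.
- have [c oc _] := mulmx_out (Ordinal p_gt0) k.
  have := mul_delta (Ordinal p_gt0) u u k.
  rewrite (same _ (mulmx_data (delta_mx (Ordinal p_gt0) u) 0) _ _ oc).
    by rewrite P_mul mulmx0 mxE eqxx => /eqP; rewrite eq_sym oner_eq0.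
  case=> [//|[u' k']] /= h; rewrite !mxE; case: andP => // -[/eqP e1 /eqP e2].
  by rewrite e1 e2 eqxx in h.
Qed.
End LowerBounds.

(** * Sparse polynomial arithmetic by linear operations *)

Section LinearReach.
Variables (E : Type) (L : fieldType).
Implicit Types (K : set (E -> L)) (P Q T B : E -> {poly L}) (s : {poly L}).

Definition lin_step K g : Prop :=
  g = cst 0 \/
  exists a f1 f2, [/\ K f1, K f2 & g = fun e => f1 e + a * f2 e].

Definition lreach := reach lin_step.

(* All coefficients, so [cst 0] belongs to it when the sizes are bounded. *)
Definition coefs (R : nzRingType) (P : E -> {poly R}) : set (E -> R) :=
  range (fun j e => (P e)`_j).

Definition values P (l : seq L) : set (E -> L) :=
  [set (fun e => (P e).[p]) | p in [set` l]].

Lemma lreach_monomials (T : eqType) (r : seq T) K B c f k :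
    coefs B `<=` K -> (forall t, t \in r -> K (f t)) ->
  lreach K (size r)
    (coefs (fun e => B e + \sum_(t <- r) (c t * f t e) *: 'X^(k t))).
Proof.
elim: r K B => [|t r IH] K B hB hf.
  by apply: reach_sub => _ [j _ <-]; apply: hB; exists j => //; apply/funext => e;
    rewrite big_nil addr0.
pose g e := (B e)`_(k t) + c t * f t e.
pose B' e := B e + (c t * f t e) *: 'X^(k t).
rewrite /= -add1n; apply: (@reach_trans _ _ _ _ (K `|` [set g])).
  apply: (reach_step (@subset_refl _ K)); right.
  exists (c t), (fun e => (B e)`_(k t)), (f t).
  by split=> //; [apply: hB; exists (k t)|apply: hf; rewrite mem_head].
apply: reach_sub_r (IH _ B' _ _).
- move=> _ [j _ <-]; exists j => //; apply/funext => e.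
  by rewrite big_cons addrA.
- move=> _ [j _ <-]; have [->|jk] := eqVneq j (k t).
    by right; apply/funext => e; rewrite coefD coefZ coefXn eqxx mulr1.
  left; apply: hB; exists j => //; apply/funext => e.
  by rewrite coefD coefZ coefXn (negbTE jk) mulr0 addr0.
- by move=> u ur; left; apply: hf; rewrite inE ur orbT.
Qed.

Lemma lreach_lincomb (J : finType) r K (Q : J -> E -> {poly L}) (c : J -> L) :
    (forall j e, (size (Q j e) <= r)%N) -> K (cst 0) ->
    (forall j, coefs (Q j) `<=` K) ->
  lreach K (#|J| * r) (coefs (fun e => \sum_j c j *: Q j e)).
Proof.
move=> sQ K0 hQ; pose l := enum {: J * 'I_r}.
have <- : size l = (#|J| * r)%N by rewrite -cardE card_prod card_ord.
apply: reach_sub_r (lreach_monomials (r := l) (B := fun=> 0) (fun u => c u.1)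
  (f := fun u e => (Q u.1 e)`_(u.2)) (fun u => val u.2) _ _).
- move=> _ [k _ <-]; exists k => //; apply/funext => e.
  apply: (congr1 (coefp k)); rewrite add0r /l big_enum /=.
  rewrite -(pair_bigA _ (fun j (v : 'I_r) => (c j * (Q j e)`_v) *: 'X^v)) /=.
  apply: eq_bigr => j _; rewrite -[Q j e in RHS]coefK poly_def.
  rewrite (big_ord_widen _ (fun i => (Q j e)`_i *: 'X^i) (sQ j e)).
  rewrite [in RHS]big_mkcond scaler_sumr; apply: eq_bigr => v _.
  case: ltnP => h; first by rewrite scalerA.
  by rewrite nth_default// mulr0 scale0r scaler0.
- by move=> _ [k _ <-]; rewrite (_ : (fun e => _) = cst 0)//;
    apply/funext => e; rewrite coef0.
- by move=> u _; apply: (hQ u.1); exists (val u.2).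
Qed.

Section SparseDivision.
Variables (n r : nat) (a : 'I_n -> L) (d : 'I_n -> nat).
Let s : {poly L} := \sum_(j < n) a j *: 'X^(d j).
Hypotheses (s_size : (size s <= r.+1)%N) (s_lead : s`_r = 1).

Lemma lreach_divp t K P :
    (forall e, (size (P e) <= r + t)%N) -> coefs P `<=` K ->
  exists Q T, [/\ forall e, P e = Q e * s + T e,
    forall e, (size (Q e) <= t)%N, forall e, (size (T e) <= r)%N
    & lreach K (t * n) (coefs Q `|` coefs T)].
Proof.
elim: t K P => [|t IH] K P sP hP.
  exists (fun=> 0), P; split=> [e|e|e|]; rewrite ?mul0r ?add0r ?size_poly0//.
    by rewrite -[r]addn0.
  apply: reach_sub => f [[j _ <-]|]; last exact: hP.
  apply: hP; exists (r + j)%N => //; apply/funext => e.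
  by rewrite coef0 nth_default// (leq_trans (sP e))// leq_add2l.
pose top e := (P e)`_(r + t).
pose P1 e := P e + \sum_(j <- enum 'I_n) (- a j * top e) *: 'X^(d j + t).
have P1E e : P e = top e *: 'X^t * s + P1 e.
  rewrite /P1 addrCA big_enum /= -[LHS]addr0; congr (_ + _).
  rewrite /s mulr_sumr -big_split big1// => j _.
  rewrite mulNr scaleNr -scalerAl -scalerAr -exprD scalerA.
  by rewrite [(t + _)%N]addnC [top e * _]mulrC; exact: subrr.
have KP1 : lreach K n (coefs P1).
  rewrite -[X in lreach _ X](size_enum_ord n).
  by apply: lreach_monomials => // j _; apply: hP; exists (r + t)%N.
have sP1 e : (size (P1 e) <= r + t)%N.
  apply/leq_sizeP => j jrt; have := congr1 (coefp j) (P1E e).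
  rewrite /= coefD -scalerAl coefZ coefXnM ltnNge (leq_trans (leq_addl r t) jrt) /=.
  move: jrt; rewrite leq_eqVlt => /orP[/eqP <-|jrt].
    rewrite addnK s_lead mulr1 => /eqP.
    by rewrite -subr_eq0 opprD addNKr oppr_eq0 => /eqP.
  rewrite (nth_default _ (leq_trans (sP e) _)) ?addnS//.
  rewrite [s`__]nth_default ?mulr0 ?add0r// (leq_trans s_size)//.
  by rewrite ltn_subRL addnC.
have [Q [T [PE sQ sT KQT]]] := IH (K `|` coefs P1) P1 sP1 (@subsetUr _ _ _).
exists (fun e => Q e + top e *: 'X^t), T; split=> [e|e|//|].
- by rewrite {1}P1E PE mulrDl addrCA addrA.
- rewrite (leq_trans (size_polyD _ _))// geq_max ltnW ?ltnS//=.
  by rewrite (leq_trans (size_scale_leq _ _))// size_polyXn.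
- rewrite mulSn; apply: reach_seq KP1 _.
  apply: reach_sub_r (reach_keep KQT).
  move=> f [[j _ <-]|Tf]; last by right; right.
  have [->|jt] := eqVneq j t.
    left; left; apply: hP; exists (r + t)%N => //; apply/funext => e.
    by rewrite coefD coefZ coefXn eqxx mulr1 [(Q e)`_t]nth_default ?add0r ?sQ.
  right; left; exists j => //; apply/funext => e.
  by rewrite coefD coefZ coefXn (negbTE jt) mulr0 addr0.
Qed.

Lemma lreach_expand D K P :
    (forall e, (size (P e) <= r * D)%N) -> coefs P `<=` K ->
  exists P_ : nat -> E -> {poly L},
    [/\ forall e, P e = \sum_(j < D) P_ j e * s ^+ j,
        forall j e, (size (P_ j e) <= r)%N
      & lreach K (D * (r * D * n)) (\bigcup_j coefs (P_ j))].
Proof.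
elim: D K P => [|D IH] K P sP hP.
  have P0 e : P e = 0 by have := sP e; rewrite muln0 size_poly_leq0 => /eqP.
  exists (fun=> P); split=> [e|j e|]; first by rewrite P0 big_ord0.
    by rewrite P0 size_poly0.
  by apply: reach_sub => f [j _]; apply: hP.
have sP' e : (size (P e) <= r + r * D)%N by rewrite -mulnS.
have [Q [T [PE sQ sT KQT]]] := lreach_divp sP' hP.
have hQ : coefs Q `<=` K `|` (coefs Q `|` coefs T) by move=> f; right; left.
have [Q_ [QE sQ_ KQ_]] := IH _ _ sQ hQ.
exists (fun j => if j is j'.+1 then Q_ j' else T); split=> [e|[|j] e|//].
- rewrite big_ord_recl /= mulr1 PE QE mulr_suml addrC; congr (_ + _).
  by apply: eq_bigr => j _; rewrite exprSr mulrA.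
- exact: sT.
- exact: sQ_.
- apply: reach_le (reach_seq KQT
    (reach_sub_r _ (reach_keep KQ_))).
    rewrite mulSn leq_add// ?leq_mul// ?leq_mul2l ?leqnSn ?orbT//.
  move=> f [[|j] _ hf]; first by left; right; right.
  by right; exists j.
Qed.

Lemma lreach_sparse_mul M K T B :
    (forall e, (size (T e) <= M)%N) -> coefs T `<=` K -> coefs B `<=` K ->
  lreach K (M * n) (coefs (fun e => B e + T e * s)).
Proof.
move=> sT hT hB.
pose l := enum {: 'I_M * 'I_n}.
have <- : size l = (M * n)%N by rewrite -cardE card_prod !card_ord.
apply: reach_sub_r (lreach_monomials (r := l) (fun u => a u.2)
  (f := fun u e => (T e)`_(u.1)) (fun u => (u.1 + d u.2)%N) hB _).
  move=> _ [j _ <-]; exists j => //; apply/funext => e; apply: (congr1 (coefp j)).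
  congr (_ + _); rewrite /l big_enum /=.
  rewrite -(pair_bigA _ (fun (u : 'I_M) (v : 'I_n) =>
    (a v * (T e)`_u) *: 'X^(u + d v))) /=.
  rewrite -[T e in RHS](coefK (T e)) poly_def.
  rewrite (big_ord_widen _ (fun i => (T e)`_i *: 'X^i) (sT e)).
  rewrite mulr_suml [RHS]big_mkcond; apply: eq_bigr => u _.
  case: ifP => [_|/negbT]; last first.
    rewrite -leqNgt => h; rewrite big1// => v _.
    by rewrite nth_default// mulr0 scale0r.
  rewrite /s mulr_sumr; apply: eq_bigr => v _.
  by rewrite -scalerAl -scalerAr -exprD scalerA mulrC.
by move=> u _; apply: hT; exists (val u.1).
Qed.

Lemma size_expansion D (P_ : nat -> {poly L}) :
    (forall j, (size (P_ j) <= r)%N) ->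
  (size (\sum_(j < D) P_ j * s ^+ j)%R <= r * D)%N.
Proof.
elim: D P_ => [|D IH] P_ sP; first by rewrite big_ord0 size_poly0.
rewrite big_ord_recl mulr1; apply: leq_trans (size_polyD _ _) _.
rewrite geq_max mulnS (leq_trans (sP _)) ?leq_addr//=.
rewrite (_ : \sum_(i < D) _ = (\sum_(j < D) P_ j.+1 * s ^+ j) * s).
  apply: leq_trans (size_polyMleq _ _) _.
  have h := IH (P_ \o succn) (fun j => sP j.+1).
  by rewrite -subn1 leq_subLR (leq_trans (leq_add h s_size))// addnS add1n addnC.
by rewrite mulr_suml; apply: eq_bigr => j _; rewrite exprSr mulrA.
Qed.

Lemma lreach_horner D K (P_ : nat -> E -> {poly L}) :
    (forall j e, (size (P_ j e) <= r)%N) -> K (cst 0) ->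
    (forall j, coefs (P_ j) `<=` K) ->
  lreach K (D * (r * D * n)) (coefs (fun e => \sum_(j < D) P_ j e * s ^+ j)).
Proof.
elim: D P_ => [|D IH] P_ sP K0 hP.
  apply: reach_sub => _ [j _ <-].
  by rewrite (_ : (fun e => _) = cst 0)//; apply/funext => e; rewrite big_ord0 coef0.
pose T e := \sum_(j < D) P_ j.+1 e * s ^+ j.
have sT e : (size (T e) <= r * D)%N.
  exact: (@size_expansion D (fun j => P_ j.+1 e)).
have KT := IH (P_ \o succn) (fun j => sP j.+1) K0 (fun j => hP j.+1).
apply: reach_le (reach_seq KT
  (reach_sub_r _ (lreach_sparse_mul sT (B := P_ 0%N) _ _))).
- rewrite addnC mulSn leq_add// ?leq_mul// ?leq_mul2l ?leqnSn ?orbT//.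
- move=> _ [j _ <-]; exists j => //; apply/funext => e; apply: (congr1 (coefp j)).
  rewrite big_ord_recl mulr1 /T mulr_suml; congr (_ + _).
  by apply: eq_bigr => i _; rewrite exprSr mulrA.
- by move=> f; right.
- by move=> f hf; left; apply: (hP 0%N).
Qed.
End SparseDivision.
End LinearReach.

(** * Finite field extensions *)

Section FiniteFieldExtension.
Variable F : finFieldType.

Lemma finField_pchar_nat (R : nzRingType) :
  [pchar F] =i [pchar R] -> [pchar R].-nat #|F|.
Proof.
move=> FR; have [p p_pr pF] := finPcharP F.
have := fin_ring_pchar_abelem pF => /and3P[pG _ _].
rewrite -cardsT; apply: sub_in_pnat pG => r _.
by rewrite inE /= => /eqP ->; rewrite -FR.
Qed.

Lemma fieldExt_of_dim m : (0 < m)%N ->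
  exists L : fieldExtType F, \dim {:L} = m.
Proof.
move=> m_gt0; have q_gt1 : (1 < #|F|)%N := finNzRing_gt1 F.
pose N := (#|F| ^ m)%N; pose g (R : nzRingType) : {poly R} := 'X^N - 'X.
have N_gt1 : (1 < N)%N by rewrite (ltn_exp2l 0).
have size_g (R : nzRingType) : size (g R) = N.+1.
  by rewrite size_polyDl ?size_polyXn// size_polyN size_polyX.
have /FinSplittingFieldFor[/= L [zs gL _]] : g F != 0.
  by rewrite -size_poly_gt0 size_g.
rewrite [map_poly _ _]rmorphB rmorphXn /= map_polyX -/(g L) in gL.
have NL0 : N%:R = 0 :> L.
  have F0 : #|F|%:R = 0 :> F.
    by rewrite -FinRing.zmodXgE -cardsT expg_cardG ?inE.
  by rewrite natrX -(rmorph_nat (in_alg L)) F0 rmorph0 expr0n gtn_eqF.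
have Uzs : uniq zs.
  rewrite -separable_prod_XsubC -(eqp_separable gL) unlock /g.
  rewrite derivB derivXn derivX -mulr_natr -polyC_natr NL0 polyC0 mulr0 sub0r.
  by rewrite coprimep_sym -scaleN1r coprimepZl ?coprime1p// oppr_eq0 oner_eq0.
have [a _ /= aE] := finField_galois_generator (sub1v {:L}%AS).
rewrite dimv1 expn1 in aE.
pose V : {subfield L} := [aspace of fixedSpace (a ^+ m)%g].
exists (subvs_of V : fieldExtType F); rewrite dimvf.
have zsV : zs =i V.
  move=> z; rewrite -root_prod_XsubC -(eqp_root gL) (sameP fixedSpaceP eqP).
  rewrite /root !hornerE subr_eq0 /= /N; congr (_ == z).
  elim: (m) => [|i IHi]; first by rewrite gal_id.
  by rewrite expgSr expnSr exprM IHi galM ?aE ?memvf.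
apply: (@expnI #|F|) => //.
rewrite -[RHS]/N -[(#|F| ^ _)%N](@card_vspace F (finvect_type L) _ V).
have -> : #|(V : {vspace finvect_type L})| = size zs.
  by rewrite -(card_uniqP (Uzs : @uniq (finvect_type L) zs)); apply: eq_card => z.
by apply: succn_inj; rewrite -(size_prod_XsubC zs id) -(eqp_size gL) size_g.
Qed.
End FiniteFieldExtension.

(** * The additive FFT *)

Section AdditiveFFT.
Variables (F : finFieldType) (L : fieldExtType F).
Local Notation q := #|F|.

Let q_gt1 : (1 < q)%N := finNzRing_gt1 F.
Let q_gt0 : (0 < q)%N := ltnW q_gt1.

Definition evaluable (E : Type) N c (l : seq L) : Prop :=
  forall K (P : E -> {poly L}), (forall e, (size (P e) <= N)%N) ->
    coefs P `<=` K -> lreach K c (values P l).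

Definition interpolable (E : Type) N c (l : seq L) : Prop :=
  forall K (P : E -> {poly L}), (forall e, (size (P e) <= N)%N) ->
    K (cst 0) -> values P l `<=` K -> lreach K c (coefs P).

Definition fft_cost i := (2 * q * i ^ 2 * q ^ i)%N.

Definition fft_level i (s : {poly L}) (pts : L -> seq L) : Prop :=
  [/\ exists a : 'I_i.+1 -> L, s = \sum_(j < i.+1) a j *: 'X^(q ^ j),
      s`_(q ^ i) = 1 /\ (size s <= (q ^ i).+1)%N,
      forall x, size (pts x) = (q ^ i)%N,
      forall x p, p \in pts x -> s.[p] = s.[x]
    & forall E x, evaluable E (q ^ i) (fft_cost i) (pts x) /\
        interpolable E (q ^ i) (fft_cost i) (pts x)].

Lemma pchar_nat_ext (R : nzRingType) : [pchar R] =i [pchar L] ->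
  forall i, [pchar R].-nat (q ^ i)%N.
Proof.
move=> RL i; rewrite pnatX (finField_pchar_nat (R := R))// => p.
by rewrite RL pchar_lalg.
Qed.

Lemma expqD i (x y : L) : (x + y) ^+ (q ^ i) = x ^+ (q ^ i) + y ^+ (q ^ i).
Proof. by rewrite exprDn_pchar// pchar_nat_ext. Qed.

Lemma expq_alg i (c : F) : c%:A ^+ (q ^ i) = c%:A :> L.
Proof.
rewrite -[c%:A]/(in_alg L c) -rmorphXn; congr (in_alg L _).
by elim: i => // i IH; rewrite expnSr exprM IH expf_card.
Qed.

Lemma horner_linearized i (a : 'I_i -> L) (c : F) (x y : L) :
  let s := \sum_(j < i) a j *: 'X^(q ^ j) in
  s.[x + c%:A * y] = s.[x] + c%:A * s.[y].
Proof.
rewrite /= !horner_sum mulr_sumr -big_split; apply: eq_bigr => j _ /=.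
rewrite !hornerE expqD exprMn expq_alg mulrDr; congr (_ + _).
by rewrite mulrA [a j * _]mulrC.
Qed.

Lemma exists_nonroot (s : {poly L}) :
  s != 0 -> (size s <= q ^ \dim {:L})%N -> exists b, s.[b] != 0.
Proof.
move=> s0 ss; apply: contrapT => nb.
pose r2v := @VectorInternalTheory.r2v F L.
pose l := [seq r2v v | v <- enum 'rV[F]_(dim L)].
have : (size l < size s)%N.
  apply: max_poly_roots => //.
    apply/allP => x _; rewrite rootE; apply/negPn/negP => sx.
    by apply: nb; exists x.
  rewrite map_inj_uniq ?enum_uniq//; exact: VectorInternalTheory.r2v_inj.
by rewrite size_map -cardE card_mx mul1n -dimvf ltnNge ss.
Qed.

Lemma fft_level0 : fft_level 0 'X (fun x => [:: x]).
Proof.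
split=> [||//|x p|E x].
- by exists (fun=> 1); rewrite big_ord1 scale1r expn0 expr1.
- by rewrite expn0 coefX size_polyX.
- by rewrite inE => /eqP->.
- split=> K P sP => [hP|K0 hP]; apply: reach_sub.
    move=> _ [p + <-]; rewrite /= inE => /eqP ->; apply: hP; exists 0%N => //.
    by apply/funext => e; rewrite [in RHS](size1_polyC (sP e)) hornerC.
  move=> _ [[|j] _ <-].
    apply: hP; exists x; first by rewrite /= mem_head.
    by apply/funext => e; rewrite (size1_polyC (sP e)) hornerC coefC eqxx.
  rewrite (_ : (fun e => _) = cst 0)//.
  by apply/funext => e; rewrite nth_default// (leq_trans (sP e)).
Qed.

Lemma vandermonde_inv n (g : 'I_n -> L) : injective g ->
  exists v : 'I_n -> 'I_n -> L, forall (V : lmodType L) (P : nat -> V) (j : 'I_n),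
    P j = \sum_k v j k *: \sum_(i < n) g k ^+ i *: P i.
Proof.
move=> g_inj; pose M := Vandermonde n (\row_k g k).
have Mu : M \in unitmx.
  rewrite unitmxE det_Vandermonde unitfE; apply/prodf_neq0 => i _.
  apply/prodf_neq0 => j ij; rewrite !mxE subr_eq0.
  by apply: contraTneq ij => /g_inj ->; rewrite ltnn.
exists (fun j k => invmx M k j) => V P j.
under eq_bigr do rewrite scaler_sumr.
rewrite exchange_big (bigD1 j)//= [X in _ + X]big1 ?addr0 => [|i ij].
  under eq_bigr do rewrite scalerA mulrC.
  rewrite -scaler_suml -[LHS]scale1r; congr (_ *: _).
  have := congr1 (fun A : 'M[L]_n => A j j) (mulmxV Mu); rewrite !mxE eqxx => h.
  rewrite -[LHS]/(true%:R : L) -h.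
  by apply: eq_bigr => k _; rewrite !mxE.
under eq_bigr do rewrite scalerA mulrC.
rewrite -scaler_suml; have := congr1 (fun A : 'M[L]_n => A i j) (mulmxV Mu).
rewrite !mxE (negbTE ij) mulr0n => h; rewrite [X in X *: _](_ : _ = 0) ?scale0r//.
by rewrite -[RHS]h; apply: eq_bigr => k _; rewrite !mxE.
Qed.

Section Step.
Variables (i : nat) (s : {poly L}) (pts : L -> seq L) (b : L).
Hypotheses (lvl : fft_level i s pts) (sb : s.[b] != 0).

Let node x (k : 'I_q) : L := x + (enum_val k)%:A * b.
Let next_pts x : seq L := flatten [seq pts (node x k) | k <- enum 'I_q].
Let next_s : {poly L} := s ^+ q - s.[b] ^+ q.-1 *: s.

Lemma horner_node x k : s.[node x k] = s.[x] + (enum_val k)%:A * s.[b].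
Proof. by have [[a ->] _ _ _ _] := lvl; rewrite horner_linearized. Qed.

Lemma node_inj x : injective (fun k => s.[node x k]).
Proof.
move=> k k'; rewrite !horner_node => /addrI /(mulIf sb).
move=> /(fmorph_inj (in_alg L)); exact: enum_val_inj.
Qed.

Lemma next_pts_size x : size (next_pts x) = (q ^ i.+1)%N.
Proof.
have [_ _ szp _ _] := lvl.
rewrite size_flatten /shape -map_comp sumnE big_map big_enum /=.
by under eq_bigr do rewrite szp; rewrite sum_nat_const card_ord expnS.
Qed.

Lemma next_ptsP x p :
  p \in next_pts x -> exists k, p \in pts (node x k).
Proof. by case/flattenP => _ /mapP[k _ ->]; exists k. Qed.

Lemma horner_next x p : p \in next_pts x -> next_s.[p] = next_s.[x].
Proof.
have [_ _ _ sp _] := lvl; case/next_ptsP => k /sp pk.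
rewrite /next_s !hornerE pk horner_node.
have := expqD 1; rewrite expn1 => ->; rewrite exprMn.
have := expq_alg 1 (enum_val k); rewrite expn1 => ->.
rewrite mulrDr opprD addrACA [_ * (_ * s.[b])]mulrCA -exprSr prednK//.
by rewrite subrr addr0.
Qed.

Lemma next_sparse :
  exists a : 'I_i.+2 -> L, next_s = \sum_(j < i.+2) a j *: 'X^(q ^ j).
Proof.
have [[a sE] _ _ _ _] := lvl.
exists (fun j => (if unlift ord0 j is Some j' then a j' ^+ q else 0) -
  (if unlift ord_max j is Some j' then s.[b] ^+ q.-1 * a j' else 0)).
rewrite /next_s.
under [RHS]eq_bigr do rewrite scalerBl.
rewrite sumrB; congr (_ - _).
  rewrite big_ord_recl unlift_none scale0r add0r sE.
  have -> (T : Type) (r : seq T) (f : T -> {poly L}) :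
      (\sum_(j <- r) f j) ^+ q = \sum_(j <- r) f j ^+ q.
    apply: (big_morph (fun x : {poly L} => x ^+ q)) => [x y|].
      rewrite exprDn_pchar//; have := @pchar_nat_ext {poly L} _ 1.
      by rewrite expn1; apply => p; rewrite pchar_poly.
    by rewrite expr0n gtn_eqF.
  apply: eq_bigr => j _; rewrite liftK exprZn -exprM; congr (_ *: 'X^_).
  by rewrite -expnSr.
rewrite big_ord_recr /= unlift_none scale0r addr0 {2}sE scaler_sumr.
apply: eq_bigr => j _; rewrite scalerA (_ : widen_ord _ _ = lift ord_max j) ?liftK//.
by apply: val_inj; rewrite [RHS]lift_max.
Qed.

Lemma next_lead : next_s`_(q ^ i.+1) = 1 /\ (size next_s <= (q ^ i.+1).+1)%N.
Proof.
have [_ [sl ss] _ _ _] := lvl.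
have szs : size s = (q ^ i).+1.
  apply/eqP; rewrite eqn_leq ss ltnNge; apply/negP => h.
  by have /eqP := sl; rewrite nth_default// eq_sym oner_eq0.
have smon : s \is monic by rewrite monicE lead_coefE szs /= sl.
have szq : size (s ^+ q) = (q ^ i.+1).+1.
  rewrite -[LHS]prednK ?size_exp ?szs -?expnSr//.
  by rewrite size_poly_gt0 expf_neq0 ?monic_neq0.
have lt : (size (s.[b] ^+ q.-1 *: s) < (q ^ i.+1).+1)%N.
  rewrite (leq_ltn_trans (size_scale_leq _ _))// szs ltnS.
  by rewrite ltn_exp2l.
split; last first.
  rewrite (leq_trans (size_polyD _ _))// geq_max szq size_polyN leqnn.
  exact: ltnW.
rewrite coefB [X in _ - X]nth_default ?subr0//.
by have /monicP := monic_exp q smon; rewrite lead_coefE szq.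
Qed.

Section Reduction.
Variables (E : Type) (P : E -> {poly L}) (P_ : nat -> E -> {poly L}) (x : L).
Hypothesis PE : forall e, P e = \sum_(j < q) P_ j e * s ^+ j.
Hypothesis sP_ : forall j e, (size (P_ j e) <= q ^ i)%N.

Definition residue (k : 'I_q) e := \sum_(j < q) s.[node x k] ^+ j *: P_ j e.

Lemma size_residue k e : (size (residue k e) <= q ^ i)%N.
Proof.
apply: leq_trans (size_sum _ _ _) _; apply/bigmax_leqP => j _.
by rewrite (leq_trans (size_scale_leq _ _)).
Qed.

Lemma horner_residue k e p :
  p \in pts (node x k) -> (P e).[p] = (residue k e).[p].
Proof.
have [_ _ _ sp _] := lvl; move=> /sp pk; rewrite PE !horner_sum.
by apply: eq_bigr => j _; rewrite !hornerE pk mulrC.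
Qed.
End Reduction.

Lemma next_evaluable E x :
  evaluable E (q ^ i.+1) (fft_cost i.+1) (next_pts x).
Proof.
have [[a sE] [sl ss] _ _ ev] := lvl => K P sP hP.
have sP' e : (size (P e) <= q ^ i * q)%N by rewrite -expnSr.
rewrite sE in sl ss.
have [P_ [PE sP_ KP_]] := lreach_expand ss sl sP' hP; rewrite -sE in PE.
pose K1 := K `|` \bigcup_j coefs (P_ j).
have P_K1 j : coefs (P_ j) `<=` K1 by move=> f; right; exists j.
have K10 : K1 (cst 0).
  left; apply: hP; exists (q ^ i.+1)%N => //.
  by apply/funext => e; rewrite nth_default.
have step k : lreach K1 (q * q ^ i + fft_cost i) (values P (pts (node x k))).
  have r1 := lreach_lincomb (fun j : 'I_q => s.[node x k] ^+ j)
    (fun j : 'I_q => sP_ j) K10 (fun j : 'I_q => P_K1 j).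
  rewrite card_ord in r1; apply: reach_seq r1 _.
  apply: reach_sub_r ((ev E (node x k)).1 _ (residue P_ x k) _ _).
  - move=> _ [p pk <-]; exists p => //; apply/funext => e.
    by rewrite (horner_residue PE _ pk).
  - exact: size_residue.
  - by move=> f hf; right.
apply: reach_le (reach_seq KP_ (reach_sub_r _ (reach_fin step))).
  rewrite card_ord /fft_cost !expnS.
  move: (q ^ i)%N (q) => y z; nia.
move=> _ [p /= /next_ptsP[k pk] <-]; exists k => //.
by exists p.
Qed.

Lemma next_interpolable E x :
  interpolable E (q ^ i.+1) (fft_cost i.+1) (next_pts x).
Proof.
have [[a sE] [sl ss] _ _ ev] := lvl => K P sP K0 hP.
have sP' e : (size (P e) <= q ^ i * q)%N by rewrite -expnSr.
have sl' := sl; have ss' := ss; rewrite sE in sl' ss'.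
have [P_ [PE sP_ _]] := lreach_expand ss' sl' sP' (@subset_refl _ (coefs P)).
rewrite -sE in PE.
have step1 k : lreach K (fft_cost i) (coefs (residue P_ x k)).
  apply: (ev E (node x k)).2 => // [e|_ [p pk <-]]; first exact: size_residue.
  apply: hP; exists p; last by apply/funext => e; rewrite (horner_residue PE _ pk).
  apply/flattenP; exists (pts (node x k)) => //.
  by apply/mapP; exists k; rewrite ?mem_enum.
have [v vP] := vandermonde_inv (node_inj (x := x)).
pose K1 := K `|` \bigcup_k coefs (residue P_ x k).
have step2 (j : 'I_q) : lreach K1 (q * q ^ i) (coefs (P_ j)).
  rewrite -{1}[q]card_ord.
  apply: reach_sub_r (lreach_lincomb (v j) (Q := residue P_ x) _ _ _).
  - move=> _ [l _ <-]; exists l => //; apply/funext => e.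
    by rewrite [in RHS](vP _ (fun j => P_ j e) j).
  - exact: size_residue.
  - by left.
  - by move=> k f hf; right; exists k.
pose Q j := if (j < q)%N then P_ j else cst 0.
have r3 := lreach_horner ss' q (P_ := Q)
  (K := K1 `|` \bigcup_(j : 'I_q) coefs (P_ j)).
apply: reach_le (reach_seq (reach_fin step1) (reach_seq (reach_fin step2)
  (reach_sub_r _ (r3 _ _ _)))).
- rewrite !card_ord /fft_cost !expnS.
  move: (q ^ i)%N (q) => y z; nia.
- move=> _ [j _ <-]; exists j => //; apply/funext => e; apply: (congr1 (coefp j)).
  by rewrite PE sE; apply: eq_bigr => k _; rewrite /Q ltn_ord.
- by move=> j e; rewrite /Q; case: ifP; rewrite ?size_poly0.
- by left; left.
- move=> j f; rewrite /Q; case: ltnP => jq; first by right; exists (Ordinal jq).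
  by move=> [k _ <-]; left; left; rewrite (_ : (fun e => _) = cst 0)//;
    apply/funext => e; rewrite coef0.
Qed.

Lemma fft_level_next : fft_level i.+1 next_s next_pts.
Proof.
split; [exact: next_sparse|exact: next_lead|exact: next_pts_size
  |exact: horner_next|].
by move=> E x; split; [exact: next_evaluable|exact: next_interpolable].
Qed.
End Step.

Lemma additive_fft i : (i <= \dim {:L})%N -> exists s pts, fft_level i s pts.
Proof.
elim: i => [|i IH] iL; first by exists 'X, (fun x => [:: x]); exact: fft_level0.
have [s [pts lvl]] := IH (ltnW iL); have [_ [sl ss] _ _ _] := lvl.
have [|//|b sb] := @exists_nonroot s.
- by apply: contra_eqN sl => /eqP ->; rewrite coef0 eq_sym oner_eq0.
- by rewrite (leq_trans ss)// ltn_exp2l.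
by do 2!eexists; apply: fft_level_next lvl sb.
Qed.
End AdditiveFFT.

(** * Products of polynomial matrices *)

Section ArithmeticSums.
Variables (E : Type) (F : fieldType).
Implicit Types (K : set (E -> F)).

Lemma areach_sum (T : eqType) (r : seq T) K f0 (f : T -> E -> F) :
    K f0 -> (forall t, t \in r -> K (f t)) ->
  areach K (size r) [set fun e => f0 e + \sum_(t <- r) f t e].
Proof.
elim: r K f0 => [|t r IH] K f0 K0 Kf.
  by apply: reach_sub => _ ->; rewrite (_ : (fun e => _) = f0)//;
    apply/funext => e; rewrite big_nil addr0.
rewrite /= -add1n; apply: reach_seq (areach_add K0 (Kf t (mem_head _ _))) _.
apply: reach_sub_r (IH _ (f0 \+ f t) _ _) => [_ ->||u ur].
- by apply/funext => e; rewrite big_cons addrA.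
- by right.
- by left; apply: Kf; rewrite inE ur orbT.
Qed.

Lemma areach_scale K a f : K f -> areach K 2 [set fun e => a * f e].
Proof.
move=> Kf; apply: (reach_seq (areach_cst K a)).
by apply: areach_mul; [right|left].
Qed.

Lemma areach_lincomb (T : finType) K f0 (c : T -> F) (f : T -> E -> F) :
    K f0 -> (forall t, K (f t)) ->
  areach K (3 * #|T|) [set fun e => f0 e + \sum_t c t * f t e].
Proof.
move=> K0 Kf; rewrite mulSn addnC mulnC.
apply: reach_seq (reach_fin (fun t => areach_scale (c t) (Kf t))) _.
rewrite cardE; apply: reach_sub_r (areach_sum (r := enum T) (f0 := f0)
  (f := fun t e => c t * f t e) _ _) => [_ ->||t _].
- by apply/funext => e; rewrite big_enum.
- by left.
- by right; exists t.
Qed.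
End ArithmeticSums.

Section Coordinates.
Variables (E : Type) (F : fieldType) (L : fieldExtType F).
Local Notation m := (\dim {:L}).
Local Notation B := (vbasis {:L}).
Implicit Types (K Z : set (E -> L)) (A : E -> {poly F}).

Definition crd (k : 'I_m) (x : L) : F := coord B k x.

Lemma crdE x : x = \sum_(k : 'I_m) crd k x *: B`_k.
Proof. by rewrite -coord_vbasis ?memvf. Qed.

Lemma crdD k x y : crd k (x + y) = crd k x + crd k y.
Proof. exact: linearD. Qed.

Lemma crdZ k a x : crd k (a *: x) = a * crd k x.
Proof. exact: linearZ. Qed.

Lemma crd0 k : crd k 0 = 0.
Proof. exact: linear0. Qed.

Lemma crd_sum k (T : Type) (r : seq T) (f : T -> L) :
  crd k (\sum_(t <- r) f t) = \sum_(t <- r) crd k (f t).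
Proof. exact: linear_sum. Qed.

Lemma crdM k x y :
  crd k (x * y) =
    \sum_(u : 'I_m * 'I_m) crd k (B`_u.1 * B`_u.2) * (crd u.1 x * crd u.2 y).
Proof.
rewrite {1}[x]crdE {1}[y]crdE mulr_suml crd_sum.
rewrite -(pair_bigA _ (fun i j : 'I_m =>
  crd k (B`_i * B`_j) * (crd i x * crd j y))) /=.
apply: eq_bigr => i _; rewrite mulr_sumr crd_sum; apply: eq_bigr => j _.
by rewrite -scalerAl -scalerAr !crdZ mulrA mulrC.
Qed.

Lemma crd_scale k a x :
  crd k (a * x) = \sum_(j : 'I_m) crd k (a * B`_j) * crd j x.
Proof.
rewrite {1}[x]crdE mulr_sumr crd_sum; apply: eq_bigr => j _.
by rewrite -scalerAr crdZ mulrC.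
Qed.

Lemma exists_crd1 : exists k, crd k 1 != 0.
Proof.
apply: contrapT => h; have /eqP := oner_neq0 L; apply.
rewrite [LHS]crdE big1// => k _; rewrite [crd _ _](_ : _ = 0) ?scale0r//.
by apply/eqP/negPn/negP => hk; apply: h; exists k.
Qed.

Definition crds Z : set (E -> F) :=
  [set f | exists k g, Z g /\ f = fun e => crd k (g e)].

Lemma crds_sub Z Z' : Z `<=` Z' -> crds Z `<=` crds Z'.
Proof. by move=> s _ [k [g [/s Zg ->]]]; exists k, g. Qed.

Lemma lreach_transfer K c Z :
  lreach K c Z -> areach (crds K) (c * (3 * m ^ 2)) (crds Z).
Proof.
have m_gt0 : (0 < m)%N := adim_gt0 _.
elim=> {K c Z} [K c Z s|K0 K g s sg|K c Z c' Z' _ r1 _ r2].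
- by apply: reach_sub; apply: crds_sub.
- apply: (@reach_sub_r _ _ _ _
    (crds K `|` \bigcup_(k : 'I_m) [set fun e => crd k (g e)])).
    move=> _ [k [h [[Kh|->] ->]]]; first by left; exists k, h.
    by right; exists k.
  apply: reach_keep; apply: reach_le
    (reach_fin (c := (3 * m)%N) _); first by rewrite card_ord; nia.
  move=> k; case: sg => [->|[a [f1 [f2 [/s k1 /s k2 ->]]]]].
    apply: reach_le (reach_sub_r _ (areach_cst _ 0)); first by rewrite muln_gt0.
    by move=> _ ->; apply/funext => e; rewrite crd0.
  rewrite -{1}[m]card_ord; apply: reach_sub_r (areach_lincomb
    (f0 := fun e => crd k (f1 e)) (fun j : 'I_m => crd k (a * B`_j))
    (f := fun j e => crd j (f2 e)) _ _).
  + by move=> _ ->; apply/funext => e; rewrite crdD crd_scale.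
  + by exists k, f1.
  + by move=> j; exists j, f2.
- by rewrite mulnDl; apply: reach_trans r1 r2.
Qed.

Lemma areach_lift N (K : set (E -> F)) A :
    (forall e, (size (A e) <= N)%N) -> K (cst 0) -> coefs A `<=` K ->
  areach K (N * (m * 2)) (crds (coefs (fun e => map_poly (in_alg L) (A e)))).
Proof.
move=> sA K0 hA.
apply: (@reach_sub_r _ _ _ _ (K `|` \bigcup_(n : 'I_N) \bigcup_(k : 'I_m)
    [set fun e => crd k 1 * (A e)`_n])).
  move=> _ [k [_ [[n _ <-] ->]]].
  have [nN|Nn] := ltnP n N.
    right; exists (Ordinal nN) => //; exists k => //=; apply/funext => e.
    by rewrite coef_map /= crdZ mulrC.
  left; rewrite (_ : (fun e => _) = cst 0)//; apply/funext => e.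
  by rewrite coef_map nth_default ?(leq_trans (sA e))//= scale0r crd0.
apply: reach_keep; rewrite -[X in (X * _)%N]card_ord; apply: reach_fin => n.
rewrite -{1}[m]card_ord; apply: reach_fin => k.
by apply: areach_scale; apply: hA; exists n.
Qed.

Lemma areach_unlift N (K : set (E -> F)) A :
    (forall e, (size (A e) <= N)%N) -> K (cst 0) ->
    crds (coefs (fun e => map_poly (in_alg L) (A e))) `<=` K ->
  areach K (N * 2) (coefs A).
Proof.
move=> sA K0 hA; have [k k1] := exists_crd1.
pose f (n : 'I_N) e := (crd k 1)^-1 * crd k (map_poly (in_alg L) (A e))`_n.
apply: (@reach_sub_r _ _ _ _ (K `|` \bigcup_(n : 'I_N) [set f n])).
  move=> _ [n _ <-].
  have [nN|Nn] := ltnP n N.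
    right; exists (Ordinal nN) => //; apply/funext => e.
    by rewrite /f coef_map /= crdZ mulrCA mulVf ?mulr1.
  left; rewrite (_ : (fun e => _) = cst 0)//; apply/funext => e.
  by rewrite nth_default ?(leq_trans (sA e)).
apply: reach_keep; rewrite -[X in (X * _)%N]card_ord; apply: reach_fin => n.
apply: areach_scale; apply: hA; exists k.
by exists (fun e => (map_poly (in_alg L) (A e))`_n); split=> //; exists n.
Qed.
End Coordinates.

Section PolynomialMatrixProduct.
Variables (E : Type) (F : finFieldType) (p q r : nat).
Variable P : slp F ('I_p * 'I_q + 'I_q * 'I_r) ('I_p * 'I_r).
Hypothesis P_mul : mulmx_slp P.
Implicit Types (K : set (E -> F)).

Lemma areach_mulmx K (X : 'I_p -> 'I_q -> E -> F) (Y : 'I_q -> 'I_r -> E -> F) :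
    (forall i u, K (X i u)) -> (forall u j, K (Y u j)) ->
  areach K (cost P).+1
    (\bigcup_(t : 'I_p * 'I_r) [set fun e => \sum_u X t.1 u e * Y u t.2 e]).
Proof.
move=> hX hY.
pose x e := mulmx_data (\matrix_(i, u) X i u e) (\matrix_(u, j) Y u j e).
have xK l : K (fun e => x e l).
  case: l => [[i u]|[u j]].
    suff -> : (fun e => x e (inl (i, u))) = X i u by exact: hX.
    by apply/funext => e; rewrite /x /= mxE.
  suff -> : (fun e => x e (inr (u, j))) = Y u j by exact: hY.
  by apply/funext => e; rewrite /x /= mxE.
have := slp_reach P xK; apply: reach_sub_r.
move=> _ [[i j] _ ->]; exists (i, j) => //; apply/funext => e.
by rewrite /x P_mul mxE; apply: eq_bigr => u _; rewrite !mxE.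
Qed.

Definition polymulmx_cost m :=
  (12 * #|F| * m ^ 4 * #|F| ^ m * (p * q + q * r + p * r + (cost P).+1))%N.

Theorem areach_polymulmx m a b K (X : 'I_p -> 'I_q -> E -> {poly F})
    (Y : 'I_q -> 'I_r -> E -> {poly F}) :
    (0 < m)%N -> (0 < a)%N -> (0 < b)%N -> (a + b <= (#|F| ^ m).+1)%N ->
    (forall i u e, (size (X i u e) <= a)%N) ->
    (forall u j e, (size (Y u j e) <= b)%N) -> K (cst 0) ->
    (forall i u, coefs (X i u) `<=` K) -> (forall u j, coefs (Y u j) `<=` K) ->
  areach K (polymulmx_cost m)
    (\bigcup_(t : 'I_p * 'I_r) coefs (fun e => \sum_u X t.1 u e * Y u t.2 e)).
Proof.
move=> m_gt0 a_gt0 b_gt0 abm sX sY K0 hX hY.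
have [L dimL] := fieldExt_of_dim F m_gt0.
have [s [pts [_ _ szp _ ev]]] := @additive_fft F L m (eq_leq (esym dimL)).
pose l := pts 0; set N := (#|F| ^ m)%N in abm szp ev.
have szl : size l = N := szp 0.
have {ev} ev := ev E 0; case: ev; rewrite -/l => evl inl_.
have aN : (a <= N)%N by move: b_gt0 abm; clear; lia.
have bN : (b <= N)%N by move: a_gt0 abm; clear; lia.
pose lift (A : {poly F}) := map_poly (in_alg L) A.
pose W i j e := \sum_u X i u e * Y u j e.
have sW i j e : (size (W i j e) <= N)%N.
  apply: leq_trans (size_sum _ _ _) _; apply/bigmax_leqP => u _.
  apply: leq_trans (size_polyMleq _ _) _.
  by rewrite -subn1 leq_subLR add1n (leq_trans (leq_add (sX i u e) (sY u j e))).
pose SX1 := \bigcup_(t : 'I_p * 'I_q) crds (coefs (fun e => lift (X t.1 t.2 e))).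
pose SY1 := \bigcup_(t : 'I_q * 'I_r) crds (coefs (fun e => lift (Y t.1 t.2 e))).
pose SX2 := \bigcup_(t : 'I_p * 'I_q) crds (values (fun e => lift (X t.1 t.2 e)) l).
pose SY2 := \bigcup_(t : 'I_q * 'I_r) crds (values (fun e => lift (Y t.1 t.2 e)) l).
pose S3 := \bigcup_(z in [set` l]) \bigcup_(k : 'I_(\dim {:L}) * 'I_(\dim {:L}))
  \bigcup_(t : 'I_p * 'I_r) [set fun e =>
    \sum_u crd k.1 (lift (X t.1 u e)).[z] * crd k.2 (lift (Y u t.2 e)).[z]].
pose S4 := \bigcup_(t : 'I_p * 'I_r) crds (values (fun e => lift (W t.1 t.2 e)) l).
pose S5 := \bigcup_(t : 'I_p * 'I_r) crds (coefs (fun e => lift (W t.1 t.2 e))).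
have size_lift N' (A : {poly F}) : (size A <= N')%N -> (size (lift A) <= N')%N.
  by rewrite size_map_poly.
have r1 : areach K ((p * q + q * r) * (N * (m * 2))) (SX1 `|` SY1).
  rewrite mulnDl; apply: reach_setU.
    have := @reach_fin _ (@arith_step E F) ('I_p * 'I_q)%type K (N * (m * 2)).
    rewrite card_prod !card_ord; apply => t; rewrite -dimL.
    apply: areach_lift => // e; exact: leq_trans (sX _ _ _) aN.
  have := @reach_fin _ (@arith_step E F) ('I_q * 'I_r)%type K (N * (m * 2)).
  rewrite card_prod !card_ord; apply => t; rewrite -dimL.
  apply: areach_lift => // e; exact: leq_trans (sY _ _ _) bN.
have r2 : areach (K `|` (SX1 `|` SY1))
    ((p * q + q * r) * (fft_cost F m * (3 * m ^ 2))) (SX2 `|` SY2).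
  rewrite mulnDl; apply: reach_setU.
    have := @reach_fin _ (@arith_step E F) ('I_p * 'I_q)%type.
    move=> /(_ _ (fft_cost F m * (3 * m ^ 2))%N).
    rewrite card_prod !card_ord; apply => t.
    apply: (@reach_mono _ _ (crds (coefs (fun e => lift (X t.1 t.2 e))))).
      by move=> f hf; right; left; exists t.
    rewrite -[X in (3 * X ^ 2)%N]dimL; apply: lreach_transfer.
    by apply: evl => // e; apply: size_lift; exact: leq_trans (sX _ _ _) aN.
  have := @reach_fin _ (@arith_step E F) ('I_q * 'I_r)%type.
  move=> /(_ _ (fft_cost F m * (3 * m ^ 2))%N).
  rewrite card_prod !card_ord; apply => t.
  apply: (@reach_mono _ _ (crds (coefs (fun e => lift (Y t.1 t.2 e))))).
    by move=> f hf; right; right; exists t.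
  rewrite -[X in (3 * X ^ 2)%N]dimL; apply: lreach_transfer.
  by apply: evl => // e; apply: size_lift; exact: leq_trans (sY _ _ _) bN.
set K2 := (K `|` (SX1 `|` SY1) `|` (SX2 `|` SY2)).
have r3 : areach K2 (N * (m * m * (cost P).+1)) S3.
  rewrite -szl; apply: reach_bigcup => z zl.
  rewrite -[X in (X * X)%N]dimL -[X in (X * X)%N]card_ord -card_prod.
  apply: reach_fin => k.
  apply: (areach_mulmx (X := fun i u e => crd k.1 (lift (X i u e)).[z])
    (Y := fun u j e => crd k.2 (lift (Y u j e)).[z])) => [i u|u j].
    right; left; exists (i, u) => //; exists k.1.
    by exists (fun e => (lift (X i u e)).[z]); split=> //; exists z.
  right; right; exists (u, j) => //; exists k.2.
  by exists (fun e => (lift (Y u j e)).[z]); split=> //; exists z.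
have r4 : areach (K2 `|` S3) (p * r * (N * (m * (3 * (m * m))))) S4.
  have := @reach_fin _ (@arith_step E F) ('I_p * 'I_r)%type.
  move=> /(_ _ (N * (m * (3 * (m * m))))%N).
  rewrite card_prod !card_ord; apply => t.
  pose T z k : set (E -> F) := [set fun e => crd k (lift (W t.1 t.2 e)).[z]].
  apply: (@reach_sub_r _ _ _ _ (\bigcup_(z in [set` l]) \bigcup_k T z k)).
    by move=> _ [k [_ [[z zl <-] ->]]]; exists z => //; exists k.
  rewrite -szl; apply: reach_bigcup => z zl.
  rewrite -[X in (X * (3 * _))%N]dimL -[X in (X * (3 * _))%N]card_ord.
  apply: reach_fin => k.
  rewrite -[X in (3 * (X * X))%N]dimL -[X in (3 * (X * X))%N]card_ord -card_prod.
  pose g (v : 'I_(\dim {:L}) * 'I_(\dim {:L})) e :=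
    \sum_u crd v.1 (lift (X t.1 u e)).[z] * crd v.2 (lift (Y u t.2 e)).[z].
  apply: reach_sub_r (areach_lincomb (f0 := cst 0)
    (fun v : 'I_(\dim {:L}) * 'I_(\dim {:L}) =>
      crd k ((vbasis {:L})`_(v.1) * (vbasis {:L})`_(v.2))) (f := g) _ _).
  - move=> _ ->; apply/funext => e; rewrite add0r /W /lift rmorph_sum.
    rewrite horner_sum crd_sum /g.
    under [RHS]eq_bigr do rewrite mulr_sumr.
    rewrite exchange_big; apply: eq_bigr => u _ /=.
    by rewrite rmorphM hornerM crdM.
  - by do 3!left.
  - by move=> v; right; exists z => //; exists v => //; exists t.
have r5 : areach (K2 `|` S3 `|` S4) (p * r * (fft_cost F m * (3 * m ^ 2))) S5.
  have := @reach_fin _ (@arith_step E F) ('I_p * 'I_r)%type.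
  move=> /(_ _ (fft_cost F m * (3 * m ^ 2))%N).
  rewrite card_prod !card_ord; apply => t.
  apply: (@reach_mono _ _
    (crds ([set cst 0] `|` values (fun e => lift (W t.1 t.2 e)) l))).
    move=> _ [k [g [[->|hg] ->]]]; last by right; exists t => //; exists k, g.
    left; left; left; left; rewrite (_ : (fun e => _) = cst 0)//.
    by apply/funext => e; rewrite crd0.
  rewrite -[X in (3 * X ^ 2)%N]dimL; apply: lreach_transfer.
  apply: inl_ => [e||]; [exact/size_lift/sW|by left|by move=> f; right].
have r6 : areach (K2 `|` S3 `|` S4 `|` S5) (p * r * (N * 2))
    (\bigcup_(t : 'I_p * 'I_r) coefs (W t.1 t.2)).
  have := @reach_fin _ (@arith_step E F) ('I_p * 'I_r)%type.
  move=> /(_ _ (N * 2)%N); rewrite card_prod !card_ord; apply => t.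
  apply: (@areach_unlift _ _ L) => //; first by do 5!left.
  by move=> f hf; right; exists t.
apply: reach_le (reach_seq r1 (reach_seq r2 (reach_seq r3
  (reach_seq r4 (reach_seq r5 r6))))).
rewrite /polymulmx_cost /fft_cost -/N.
have : (0 < #|F|)%N by apply: ltnW; apply: finNzRing_gt1.
move: m_gt0; clear; move: (cost P) N #|F| => c N f.
move: (p * q)%N (q * r)%N (p * r)%N => x y z m_gt0 f_gt0.
pose D := (f * m ^ 4 * N)%N.
have le k : (k <= 4)%N -> (N * m ^ k <= D)%N.
  move=> k4; rewrite mulnC leq_mul2r -[(m ^ k)%N]mul1n leq_mul ?orbT//.
  by rewrite leq_pexp2l.
have h0 := le 0%N isT; have h1 := le 1%N isT; have h2 := le 2%N isT.
have h3 := le 3%N isT.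
have -> : (12 * f * m ^ 4 * N * (x + y + z + c.+1) =
    D * 12 * (x + y) + (D * 12 * c.+1 + D * 12 * z))%N by rewrite /D; ring.
have -> : ((x + y) * (N * (m * 2)) + ((x + y) *
    (2 * f * m ^ 2 * N * (3 * m ^ 2)) + (N * (m * m * c.+1) +
    (z * (N * (m * (3 * (m * m)))) + (z * (2 * f * m ^ 2 * N * (3 * m ^ 2)) +
     z * (N * 2))))) = (N * m ^ 1 * 2 + D * 6) * (x + y) + (N * m ^ 2 * c.+1 +
     (N * m ^ 3 * 3 + D * 6 + N * m ^ 0 * 2) * z))%N by rewrite /D; ring.
apply: leq_add; first by rewrite leq_mul2r; apply/orP; right; lia.
apply: leq_add; first by rewrite leq_mul2r; apply/orP; right; lia.
by rewrite leq_mul2r; apply/orP; right; lia.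
Qed.
End PolynomialMatrixProduct.

(** * Preprocessing *)

Section PowerSeriesInverse.
Variable F : fieldType.
Implicit Types (f g h : {poly F}).

Definition eqmodX N f g : Prop := forall k, (k < N)%N -> f`_k = g`_k.

Lemma eqmodX_mulr N f g h : eqmodX N f g -> eqmodX N (f * h) (g * h).
Proof.
move=> fg k kN; rewrite !coefM; apply: eq_bigr => j _; congr (_ * _).
by apply: fg; apply: leq_ltn_trans kN; rewrite -ltnS.
Qed.

Lemma eqmodX_mull N f g h : eqmodX N f g -> eqmodX N (h * f) (h * g).
Proof. by rewrite ![h * _]mulrC; apply: eqmodX_mulr. Qed.

Lemma inverse_modX N f : f`_0 = 1 -> exists g,
  [/\ (size g <= N)%N, eqmodX N (g * f) 1 &
    forall k, (k < N)%N ->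
      g`_k = (k == 0%N)%:R + \sum_(j < k) - (g`_j * f`_(k - j))].
Proof.
move=> f0; have : coprimep f ('X^N).
  by rewrite coprimep_expr// coprimepX rootE horner_coef0 f0 oner_eq0.
case/Bezout_eq1_coprimepP => -[u v] /= uv.
have gu : eqmodX N (take_poly N u) u by move=> k kN; rewrite coef_take_poly kN.
have gf : eqmodX N (take_poly N u * f) 1.
  move=> k kN; rewrite (eqmodX_mulr _ gu kN).
  by rewrite -uv coefD coefMXn kN addr0.
exists (take_poly N u); split=> // [|k kN]; first exact: size_take_poly.
have := gf k kN; rewrite coefM big_ord_recr /= subnn f0 mulr1 coef1 => <-.
by rewrite sumrN addrAC subrr add0r.
Qed.
End PowerSeriesInverse.

Section Krylov.
Variables (F : fieldType) (n : nat).
Variables (A U C V : 'M[F]_n.+1).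
Hypothesis fnf : is_FNF A U C V.
Local Notation N := n.+1.

Definition krylov (X Y : 'M[F]_n.+1) (i : 'I_n.+1) (l : nat) : F :=
  (X ^+ l *m Y) i ord0.

Local Notation w := (krylov A U).
Let p := char_poly A.

Lemma FNF_comm : A *m U = U *m C.
Proof. by case: fnf => Uu -> _ ->; rewrite mulmxKV. Qed.

Lemma pow_mul_col k i (l : 'I_N) : (A ^+ k *m U) i l = w i (k + l).
Proof.
have col0 (j : nat) (jN : (j < N)%N) i' :
    U i' (Ordinal jN) = (A ^+ j *m U) i' ord0.
  elim: j jN i' => [|j IH] jN i'.
    by rewrite expr0 mul1mx; congr (U _ _); apply: val_inj.
  rewrite exprS -mulmxE -mulmxA mxE.
  have jN' := ltnW jN; under eq_bigr do rewrite -(IH jN').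
  have -> : \sum_j0 A i' j0 * U j0 (Ordinal jN') = (A *m U) i' (Ordinal jN').
    by rewrite mxE.
  rewrite FNF_comm mxE (bigD1 (Ordinal jN)) //= big1 => [|u uj].
    case: fnf => _ _ -> _; rewrite mxE /= ltn_eqF// eqxx mulr1 addr0.
    by [].
  case: fnf => _ _ -> _; rewrite mxE /= ltn_eqF//.
  case: eqP => [uE|_]; last by rewrite mulr0.
  by case/eqP: uj; apply: val_inj.
rewrite /krylov exprD -mulmxE -mulmxA !mxE; apply: eq_bigr => j _.
by rewrite -(col0 l (ltn_ord l)); congr (_ * U _ _); apply: val_inj.
Qed.

Lemma pow_entry k i j : (A ^+ k) i j = \sum_(l < N) w i (k + l) * V l j.
Proof.
have [Uu VU _ _] := fnf.
rewrite -[A ^+ k]mulmx1 -(mulmxV Uu) -VU mulmxA mxE.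
by apply: eq_bigr => l _; rewrite pow_mul_col.
Qed.

Lemma krylov_rec l i : \sum_(j < N.+1) p`_j * w i (l + j) = 0.
Proof.
have CH : \sum_(j < N.+1) p`_j *: A ^+ j = 0.
  rewrite -[RHS](Cayley_Hamilton A) -[in RHS](coefK (char_poly A)) poly_def.
  rewrite size_char_poly linear_sum; apply: eq_bigr => j _ /=.
  by rewrite horner_mxZ rmorphXn /= horner_mx_X.
have : A ^+ l *m (\sum_(j < N.+1) p`_j *: A ^+ j) *m U = 0.
  by rewrite CH mulmx0 mul0mx.
move=> /matrixP /(_ i ord0); rewrite [RHS]mxE => h; rewrite -[RHS]h {h}.
rewrite mulmx_sumr mulmx_suml summxE; apply: eq_bigr => j _.
by rewrite -scalemxAr -scalemxAl mxE /krylov exprD -mulmxE.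
Qed.

Definition rev_char_poly (X : 'M[F]_n.+1) : {poly F} :=
  \poly_(j < N.+1) (char_poly X)`_(N - j).
Definition row_poly (X : 'M[F]_n.+1) i : {poly F} :=
  \poly_(l < N) X i (inord l).

Lemma rev_char_poly0 : (rev_char_poly A)`_0 = 1.
Proof.
rewrite coef_poly subn0; have := char_poly_monic A.
by rewrite monicE lead_coefE size_char_poly => /eqP.
Qed.

Lemma rev_char_polyS j : (j < N)%N ->
  (rev_char_poly A)`_j.+1 = - C (inord (N - j.+1)) ord_max.
Proof.
move=> jN; rewrite coef_poly ltnS jN; case: fnf => _ _ -> _.
by rewrite mxE eqxx inordK ?opprK// subSS ltnS leq_subr.
Qed.

Definition numerator (i : 'I_N) : {poly F} :=
  take_poly N (row_poly U i * rev_char_poly A).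

Lemma krylov_series g i k :
  eqmodX (2 * N) (g * rev_char_poly A) 1 -> (k < 2 * N)%N ->
  (numerator i * g)`_k = w i k.
Proof.
move=> gP k2N; pose W : {poly F} := \poly_(l < 2 * N) w i l.
have Wl l : (l < 2 * N)%N -> W`_l = w i l by rewrite coef_poly => ->.
have num : eqmodX (2 * N) (numerator i) (W * rev_char_poly A).
  move=> l l2; rewrite coef_take_poly; case: ltnP => [lN|Nl].
    apply: (eqmodX_mulr _ _ lN) => j jN.
    rewrite Wl ?coef_poly ?jN; last by rewrite mul2n -addnn ltn_addr.
    have := pow_mul_col 0 i (Ordinal jN); rewrite expr0 mul1mx add0n => <-.
    by congr (U _ _); apply: val_inj; rewrite /= inordK.
  rewrite coefM; symmetry; rewrite -[RHS](krylov_rec (l - N) i).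
  pose f j := W`_j * (rev_char_poly A)`_(l - j).
  rewrite [LHS](_ : _ = \sum_(0 <= j < l.+1) f j); last by rewrite big_mkord.
  rewrite (@big_cat_nat _ _ _ (l - N)) //=; last by rewrite ltnW// ltnS leq_subr.
  rewrite [X in X + _ = _]big_nat big1 ?add0r; last first.
    move=> j /andP[_ jl]; rewrite /f [X in _ * X]coef_poly ltnNge.
    by rewrite (_ : (N < l - j)%N) ?mulr0//; lia.
  rewrite -{1}[(l - N)%N]add0n big_addn.
  have -> : (l.+1 - (l - N) = N.+1)%N by lia.
  rewrite big_mkord; apply: eq_bigr => j _.
  have jN : (j <= N)%N by rewrite -ltnS.
  rewrite /f Wl; last by lia.
  rewrite coef_poly ifT; last by lia.
  by rewrite mulrC addnC; congr (p`_ _ * _); lia.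
rewrite (eqmodX_mulr _ num k2N) -mulrA (eqmodX_mull W (g := 1) _ k2N) ?mulr1 ?Wl//.
by rewrite mulrC.
Qed.
End Krylov.

Lemma mulmx_slp11 (F : fieldType) :
  exists P : slp F ('I_1 * 'I_1 + 'I_1 * 'I_1) ('I_1 * 'I_1),
    mulmx_slp P /\ cost P = 1%N.
Proof.
exists (Slp [:: Mul F (inl (inl (ord0, ord0))) (inl (inr (ord0, ord0)))]
  (fun=> inr 0%N)); split=> // X Y i k.
by rewrite mxE big_ord1 !ord1.
Qed.

Lemma areach_polymul (E : Type) (F : finFieldType) m a b (K : set (E -> F))
    (f g : E -> {poly F}) :
    (0 < m)%N -> (0 < a)%N -> (0 < b)%N -> (a + b <= (#|F| ^ m).+1)%N ->
    (forall e, (size (f e) <= a)%N) -> (forall e, (size (g e) <= b)%N) ->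
    K (cst 0) -> coefs f `<=` K -> coefs g `<=` K ->
  areach K (60 * #|F| * m ^ 4 * #|F| ^ m) (coefs (fun e => f e * g e)).
Proof.
move=> m0 a0 b0 ab sf sg K0 hf hg; have [P [P_mul cP]] := mulmx_slp11 F.
apply: reach_le (reach_sub_r _ (areach_polymulmx P_mul m0 a0 b0 ab
  (X := fun _ _ => f) (Y := fun _ _ => g) _ _ K0 _ _)) => //.
- by rewrite /polymulmx_cost cP; nia.
- move=> _ [j _ <-]; exists (ord0, ord0) => //; exists j => //.
  by apply/funext => e; rewrite big_ord1.
Qed.

Section Preprocessing.
Variable F : finFieldType.
Local Notation q := #|F|.

Definition fft_log (N : nat) : nat := up_log q (3 * N).

Lemma fft_log_bounds N : (0 < N)%N ->
  [/\ (0 < fft_log N)%N, (3 * N <= q ^ fft_log N)%N &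
      (q ^ fft_log N <= 3 * q * N)%N].
Proof.
move=> N0; have q1 : (1 < q)%N := finNzRing_gt1 F.
have N1 : (1 < 3 * N)%N by lia.
have /andP[lo hi] := up_log_bounds q1 N1.
have l0 : (0 < fft_log N)%N.
  rewrite /fft_log lt0n; apply/eqP => h; move: hi; rewrite h expn0; lia.
split=> //; rewrite -(prednK l0) expnS [(3 * q)%N]mulnC -mulnA leq_mul2l.
by rewrite ltnW ?orbT.
Qed.

Variable n : nat.
Local Notation N := n.+1.

Definition prep_index : finType := ('I_N * 'I_(2 * N) + 'I_N * 'I_N)%type.

Definition prep_val (A U V : 'M[F]_n.+1) (l : prep_index) : F :=
  match l with
  | inl (i, l) => krylov A U i l
  | inr (l, j) => V l j
  end.

Definition prep_cost := (400 * q ^ 2 * fft_log N ^ 4 * N ^ 2)%N.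

Lemma prep_cost_bound (f m4 M Q : nat) :
    (0 < f)%N -> (0 < m4)%N -> (0 < M)%N -> (Q <= 3 * f * M)%N ->
  (1 + (M.+1 * 1 + (2 * M * (8 * M) + (M * (60 * f * m4 * Q) +
    M * (60 * f * m4 * Q)))) <= 400 * f ^ 2 * m4 * M ^ 2)%N.
Proof.
move=> f0 m0 M0 QM; pose D := (f ^ 2 * m4 * M ^ 2)%N.
have h1 : (M * (60 * f * m4 * Q) <= 180 * D)%N.
  rewrite (_ : (180 * _)%N = (M * (60 * f * m4 * (3 * f * M)))%N).
    by rewrite !leq_mul2l QM !orbT.
  by rewrite /D; ring.
have h2 : (M ^ 2 <= D)%N by rewrite leq_pmull// muln_gt0 expn_gt0 f0.
have h3 : (M.+1 <= 2 * M ^ 2)%N by nia.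
have -> : (400 * f ^ 2 * m4 * M ^ 2 = 400 * D)%N by rewrite /D; ring.
have -> : (2 * M * (8 * M) = 16 * M ^ 2)%N by ring.
lia.
Qed.

Lemma prep_exists : exists P : slp F (FNF_index n) 'I_#|prep_index|,
  (cost P <= prep_cost)%N /\
  forall A U C V, is_FNF A U C V -> forall l,
    run (FNF_data A U C V) P l = prep_val A U V (enum_val l).
Proof.
pose E := {x : 'M[F]_n.+1 * 'M[F]_n.+1 * 'M[F]_n.+1 * 'M[F]_n.+1 |
  is_FNF x.1.1.1 x.1.1.2 x.1.2 x.2}.
pose eA (e : E) := (sval e).1.1.1; pose eU (e : E) := (sval e).1.1.2.
pose eC (e : E) := (sval e).1.2; pose eV (e : E) := (sval e).2.
have fnf e : is_FNF (eA e) (eU e) (eC e) (eV e) := svalP e.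
pose x e := FNF_data (eA e) (eU e) (eC e) (eV e).
pose K : set (E -> F) := range (fun l e => x e l).
pose rcp e := rev_char_poly (eA e).
have /choice[g gP] e := inverse_modX (2 * N) (rev_char_poly0 (eA e)).
have [m_gt0 N_le le_N] := @fft_log_bounds N isT.
set m := fft_log N in m_gt0 N_le le_N.
have r0 : areach K 1 [set cst 0] := areach_cst K 0.
pose K0 := K `|` [set cst 0].
have K00 : K0 (cst 0) by right.
have r1 : areach K0 (N.+1 * 1) (\bigcup_(j : 'I_N.+1) [set fun e => (rcp e)`_j]).
  rewrite -[X in (X * _)%N]card_ord; apply: reach_fin => -[[|j] jN].
    apply: reach_sub_r (areach_cst _ 1) => _ ->.
    by apply/funext => e; rewrite /rcp /= rev_char_poly0.
  apply: reach_sub_r (areach_sub K00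
    (g := fun e => eC e (inord (N - j.+1)) ord_max) _).
    by move=> _ ->; apply/funext => e; rewrite /= (rev_char_polyS (fnf e))// sub0r.
  by left; exists (entryC (inord (N - j.+1)) ord_max).
pose K1 := K0 `|` \bigcup_(j : 'I_N.+1) [set fun e => (rcp e)`_j].
have rcpK1 : coefs rcp `<=` K1.
  move=> _ [j _ <-]; have [jN|Nj] := ltnP j N.+1.
    by right; exists (Ordinal jN).
  left; right; apply/funext => e; rewrite nth_default//.
  exact: leq_trans (size_poly _ _) Nj.
have r2 : areach K1 (2 * N * (8 * N))
    (\bigcup_(k in `I_(2 * N)) [set fun e => (g e)`_k]).
  apply: reach_iter => k kN; set Kk := K1 `|` _.
  apply: (@reach_le _ _ _ (1 + (k * 1 + 3 * k))); first by lia.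
  pose f (j : 'I_k) e := (g e)`_j * (rcp e)`_(k - j).
  apply: reach_seq (areach_cst _ (k == 0%N)%:R) _.
  apply: (reach_seq (Z := \bigcup_j [set f j])).
    rewrite -[X in (X * _)%N]card_ord; apply: reach_fin => j.
    apply: (areach_mul (f := fun e => (g e)`_j) (g := fun e => (rcp e)`_(k - j))).
      by left; right; exists j => //=.
    by left; left; apply: rcpK1; exists (k - j)%N.
  rewrite -[X in (3 * X)%N]card_ord.
  apply: reach_sub_r (areach_lincomb (f0 := cst (k == 0%N)%:R)
    (fun=> -1) (f := f) _ _) => [_ ->||j].
  - apply/funext => e; have [_ _ ->//] := gP e.
    by congr (_ + _); apply: eq_bigr => j _; rewrite mulN1r.
  - by left; right.
  - by right; exists j.
pose K2 := K1 `|` \bigcup_(k in `I_(2 * N)) [set fun e => (g e)`_k].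
have gK2 : coefs g `<=` K2.
  move=> _ [j _ <-]; have [jN|Nj] := ltnP j (2 * N); first by right; exists j.
  left; left; right; apply/funext => e; rewrite nth_default//.
  by have [sg _ _] := gP e; exact: leq_trans sg Nj.
pose pm := (60 * q * m ^ 4 * q ^ m)%N.
have r3 : areach K2 (N * pm)
    (\bigcup_(i : 'I_N) coefs (fun e => row_poly (eU e) i * rcp e)).
  rewrite -[X in (X * _)%N]card_ord; apply: reach_fin => i.
  apply: (@areach_polymul _ _ _ N N.+1) => //.
  - by move: N_le; lia.
  - by move=> e; apply: size_poly.
  - by move=> e; apply: size_poly.
  - by left; left.
  - move=> _ [l _ <-]; have [lN|Nl] := ltnP l N.
      left; left; left; exists (entryU i (inord l)) => //.
      by apply/funext => e; rewrite coef_poly lN.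
    left; left; right; apply/funext => e; rewrite nth_default//.
    exact: leq_trans (size_poly _ _) Nl.
  - by move=> h /rcpK1; left.
pose K3 := K2 `|`
  \bigcup_(i : 'I_N) coefs (fun e => row_poly (eU e) i * rcp e).
have r4 : areach K3 (N * pm)
    (\bigcup_(i : 'I_N) coefs (fun e => numerator (eA e) (eU e) i * g e)).
  rewrite -[X in (X * _)%N]card_ord; apply: reach_fin => i.
  apply: (@areach_polymul _ _ _ N (2 * N)) => //.
  - by move: N_le; lia.
  - by move=> e; apply: size_take_poly.
  - by move=> e; have [] := gP e.
  - by left; left; left.
  - move=> _ [l _ <-]; have [lN|Nl] := ltnP l N.
      right; exists i => //; exists l => //.
      by apply/funext => e; rewrite coef_take_poly lN.
    left; left; left; right; apply/funext => e.
    by rewrite coef_take_poly ltnNge Nl.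
  - by move=> h /gK2; left.
have all := reach_keep (reach_seq r0 (reach_seq r1 (reach_seq r2
  (reach_seq r3 r4)))).
pose f (l : 'I_#|prep_index|) (e : E) := prep_val (eA e) (eU e) (eV e) (enum_val l).
have Kx h : K h -> exists l, forall e, h e = x e l by case=> l _ <-; exists l.
case: (reach_slp (D := setT) (f := f) Kx all) => [l _|P [cP runP]].
  rewrite /f; case: (enum_val l) => -[i j] /=.
    right; exists i => //; exists j => //; apply/funext => e.
    have [_ gg _] := gP e; exact: (krylov_series (fnf e)).
  by left; exists (entryV i j).
exists P; split.
  apply: leq_trans cP _; rewrite /prep_cost -/m /pm.
  have q0 : (0 < q)%N := ltnW (finNzRing_gt1 F).
  by apply: prep_cost_bound => //; rewrite expn_gt0 m_gt0.
move=> A U C V AUCV l.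
have := runP l I (exist _ (A, U, C, V) AUCV).
by [].
Qed.
End Preprocessing.

(** * Queries *)

Lemma sum_nat_mul (V : nmodType) (a b : nat) (f : nat -> V) :
  \sum_(0 <= l < a * b) f l = \sum_(i < a) \sum_(j < b) f (i * b + j)%N.
Proof.
elim: a => [|a IH]; first by rewrite mul0n big_geq// big_ord0.
rewrite big_ord_recr /= -IH mulSn addnC (@big_cat_nat _ _ _ (a * b)) ?leq_addr//=.
congr (_ + _); rewrite -{1}[(a * b)%N]add0n big_addn addKn big_mkord.
by apply: eq_bigr => j _; rewrite addnC.
Qed.

Lemma mulmx_slp_exists (F : fieldType) p q r :
  exists P : slp F ('I_p * 'I_q + 'I_q * 'I_r) ('I_p * 'I_r), mulmx_slp P.
Proof.
pose E := ('M[F]_(p, q) * 'M[F]_(q, r))%type.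
pose x (e : E) := mulmx_data e.1 e.2.
pose K : set (E -> F) := range (fun l e => x e l).
pose f (t : 'I_p * 'I_r) (e : E) := (e.1 *m e.2) t.1 t.2.
pose g (t : 'I_p * 'I_q * 'I_r) (e : E) := e.1 t.1.1 t.1.2 * e.2 t.1.2 t.2.
have r1 : areach K (#|{: 'I_p * 'I_q * 'I_r}| * 1) (\bigcup_t [set g t]).
  apply: reach_fin => -[[i u] k].
  apply: (areach_mul (f := fun e : E => e.1 i u) (g := fun e : E => e.2 u k)).
    by exists (inl (i, u)).
  by exists (inr (u, k)).
have r2 : areach (K `|` \bigcup_t [set g t])
    (#|{: 'I_p * 'I_r}| * (1 + size (enum 'I_q))) (\bigcup_t [set f t]).
  apply: reach_fin => -[i k]; apply: reach_seq (areach_cst _ 0) _.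
  apply: reach_sub_r (areach_sum (r := enum 'I_q) (f0 := cst 0)
    (f := fun u => g (i, u, k)) _ _) => [_ ->||u _].
  - by apply/funext => e; rewrite add0r big_enum /f mxE.
  - by right.
  - by left; right; exists (i, u, k).
case: (reach_slp (D := setT) (f := f) (x := x) _ (reach_seq r1 r2)).
- by move=> _ [l _ <-]; exists l.
- by move=> t _; exists t.
- by move=> P [_ runP]; exists P => X Y i k; apply: (runP (i, k) I (X, Y)).
Qed.

Section Query.
Variables (F : finFieldType) (n : nat) (S T : {set 'I_n.+1}) (h : nat).
Local Notation N := n.+1.
Local Notation q := #|F|.

Definition query_correct
    (P : slp F 'I_#|prep_index n| ('I_n.+1 * 'I_n.+1 * nat)) : Prop :=
  forall A U C V : 'M[F]_n.+1, is_FNF A U C V -> forall i j k,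
    i \in S -> j \in T -> (1 <= k <= h)%N ->
    run (fun l => prep_val A U V (enum_val l)) P (i, j, k) = (A ^+ k) i j.

Lemma query_exists Q (P : slp F ('I_#|S| * 'I_Q + 'I_Q * 'I_#|T|)
                                ('I_#|S| * 'I_#|T|)) :
    mulmx_slp P -> (1 <= h <= N)%N -> (N <= 4 * Q * h)%N ->
  exists P' : slp F 'I_#|prep_index n| ('I_n.+1 * 'I_n.+1 * nat),
    query_correct P' /\
    (cost P' <= 1 + (4 * polymulmx_cost P (fft_log F h) + #|S| * #|T| * h * 4))%N.
Proof.
move=> P_mul /andP[h_gt0 hN] NQh.
pose E := {x : 'M[F]_n.+1 * 'M[F]_n.+1 * 'M[F]_n.+1 * 'M[F]_n.+1 |
  is_FNF x.1.1.1 x.1.1.2 x.1.2 x.2}.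
pose eA (e : E) := (sval e).1.1.1; pose eU (e : E) := (sval e).1.1.2.
pose eC (e : E) := (sval e).1.2; pose eV (e : E) := (sval e).2.
have fnf e : is_FNF (eA e) (eU e) (eC e) (eV e) := svalP e.
pose x e (l : 'I_#|prep_index n|) := prep_val (eA e) (eU e) (eV e) (enum_val l).
pose K : set (E -> F) := range (fun l e => x e l).
pose K0 := K `|` [set cst 0].
have K00 : K0 (cst 0) by right.
(* [w] and [v] are padded by zeros, so that the inner dimension can be 4 Q. *)
pose w e i l := if (l < 2 * N)%N then krylov (eA e) (eU e) i l else 0.
pose v e l (j : 'I_N) := if (l < N)%N then eV e (inord l) j else 0.
have wK i l : K0 (fun e => w e i l).
  rewrite /w; case: ltnP => lN; last by right.
  left; exists (enum_rank (inl (i, Ordinal lN) : prep_index n)) => //.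
  by apply/funext => e; rewrite /x enum_rankK.
have vK l j : K0 (fun e => v e l j).
  rewrite /v; case: ltnP => lN; last by right.
  left; exists (enum_rank (inr (inord l, j) : prep_index n)) => //.
  by apply/funext => e; rewrite /x enum_rankK.
pose beta (c : 'I_4) (u : 'I_Q) := ((c * Q + u) * h)%N.
pose X c (i : 'I_#|S|) u e : {poly F} :=
  \poly_(d < 2 * h) w e (enum_val i) (beta c u + d)%N.
pose Y c u (j : 'I_#|T|) e : {poly F} :=
  \poly_(d < h) v e (beta c u + (h.-1 - d))%N (enum_val j).
have [m_gt0 h_le _] := fft_log_bounds F h_gt0.
pose Z c (i : 'I_#|S|) (j : 'I_#|T|) e := \sum_u X c i u e * Y c u j e.
have r1 : areach K0 (4 * polymulmx_cost P (fft_log F h))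
    (\bigcup_(c : 'I_4) \bigcup_(t : 'I_#|S| * 'I_#|T|) coefs (Z c t.1 t.2)).
  rewrite -[X in (X * _)%N]card_ord; apply: reach_fin => c.
  apply: (areach_polymulmx P_mul (a := (2 * h)%N) (b := h)) => //.
  - by rewrite muln_gt0.
  - by move: h_le; lia.
  - by move=> i u e; apply: size_poly.
  - by move=> u j e; apply: size_poly.
  - move=> i u _ [d _ <-]; have [dh|hd] := ltnP d (2 * h).
      suff -> : (fun e => (X c i u e)`_d) = fun e => w e (enum_val i) (beta c u + d)%N.
        exact: wK.
      by apply/funext => e; rewrite coef_poly dh.
    by right; apply/funext => e; rewrite coef_poly ltnNge hd.
  - move=> u j _ [d _ <-]; have [dh|hd] := ltnP d h.
      suff -> : (fun e => (Y c u j e)`_d) =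
          fun e => v e (beta c u + (h.-1 - d))%N (enum_val j) by exact: vK.
      by apply/funext => e; rewrite coef_poly dh.
    by right; apply/funext => e; rewrite coef_poly ltnNge hd.
pose K1 := K0 `|` \bigcup_(c : 'I_4) \bigcup_(t : 'I_#|S| * 'I_#|T|)
  coefs (Z c t.1 t.2).
pose out (t : 'I_#|S| * 'I_#|T| * 'I_h) e :=
  \sum_(c < 4) (Z c t.1.1 t.1.2 e)`_(h + t.2).
have r2 : areach K1 (#|S| * #|T| * h * 4) (\bigcup_t [set out t]).
  have := @reach_fin _ (@arith_step E F) ('I_#|S| * 'I_#|T| * 'I_h)%type K1 4.
  rewrite !card_prod !card_ord; apply => -[[i j] k].
  rewrite -[X in reach _ _ X](size_enum_ord 4).
  apply: reach_sub_r (areach_sum (r := enum 'I_4) (f0 := cst 0)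
    (f := fun c e => (Z c i j e)`_(h + k)) _ _) => [_ ->||c _].
  - by apply/funext => e; rewrite add0r big_enum.
  - by left.
  - by right; exists c => //; exists (i, j) => //; exists (h + k)%N.
pose D (o : 'I_N * 'I_N * nat) := [/\ o.1.1 \in S, o.1.2 \in T & (1 <= o.2 <= h)%N].
pose f (o : 'I_N * 'I_N * nat) (e : E) := (eA e ^+ o.2) o.1.1 o.1.2.
have outE i j k (iS : i \in S) (jT : j \in T) (kh : (k < h)%N) e :
    out (enum_rank_in iS i, enum_rank_in jT j, Ordinal kh) e = f (i, j, k.+1) e.
  rewrite /f /= (pow_entry (fnf e)).
  pose g l := w e i (k.+1 + l)%N * v e l j.
  transitivity (\sum_(0 <= l < 4 * Q * h) g l).
    rewrite sum_nat_mul.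
    rewrite -(big_mkord xpredT (fun a => \sum_(b < h) g (a * h + b)%N)).
    rewrite sum_nat_mul; apply: eq_bigr => c _; rewrite coef_sum.
    apply: eq_bigr => u _; rewrite coefMr [RHS](reindex_inj rev_ord_inj) /=.
    rewrite (big_ord_widen (h + k).+1
      (fun d => g ((c * Q + u) * h + (h - d.+1))%N)); last by lia.
    rewrite [RHS]big_mkcond; apply: eq_bigr => d _.
    rewrite [X in _ * X]coef_poly; case: ltnP => dh; last by rewrite mulr0.
    rewrite coef_poly ifT; last by lia.
    by rewrite enum_rankK_in// /g; congr (w _ _ _ * v _ _ _);
      rewrite ?enum_rankK_in// /beta; lia.
  have tail : \sum_(N <= l < 4 * Q * h) g l = 0.
    rewrite big_nat big1// => l /andP[Nl _].
    by rewrite /g /v ltnNge Nl mulr0.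
  rewrite (@big_cat_nat _ _ _ N) //= tail addr0 big_mkord.
  apply: eq_bigr => l _; rewrite /g /w /v ltn_ord.
  have -> : (k.+1 + l < 2 * N)%N by have := ltn_ord l; lia.
  by rewrite (_ : inord l = l)//; apply: val_inj; rewrite /= inordK.
have Kx g : K g -> exists l, forall e, g e = x e l by case=> l _ <-; exists l.
have all := reach_seq (areach_cst K 0) (reach_seq r1 r2).
case: (reach_slp (D := D) (f := f) Kx all) => [[[i j] k] [/= iS jT]|P' [cP' runP']].
  case: k => // k /= kh.
  exists (enum_rank_in iS i, enum_rank_in jT j, Ordinal kh) => //.
  by apply/funext => e; rewrite outE.
exists P'; split=> // A U C V AUCV i j k iS jT kh.
exact: (runP' (i, j, k) (And3 iS jT kh) (exist _ (A, U, C, V) AUCV)).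
Qed.
End Query.

(** * Running times *)

Section QueryCost.
Variable F : finFieldType.
Local Notation q := #|F|.

Definition query_factor (h : nat) : nat := (725 * q ^ 2 * fft_log F h ^ 4)%N.

Lemma query_cost_bound p Q r h
    (P : slp F ('I_p * 'I_Q + 'I_Q * 'I_r) ('I_p * 'I_r)) :
    (0 < p)%N -> (0 < Q)%N -> (0 < r)%N -> (0 < h)%N -> mulmx_slp P ->
  (1 + (4 * polymulmx_cost P (fft_log F h) + p * r * h * 4)
    <= query_factor h * h * cost P)%N.
Proof.
move=> p0 Q0 r0 h0 P_mul.
have q0 : (0 < q)%N := ltnW (finNzRing_gt1 F).
have out := mulmx_cost_out Q0 P_mul; have inp := mulmx_cost_in p0 Q0 r0 P_mul.
have [m0 _ hi] := fft_log_bounds F h0.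
have c0 : (0 < cost P)%N by apply: leq_trans out; rewrite muln_gt0 p0.
rewrite /polymulmx_cost /query_factor.
have m40 : (0 < fft_log F h ^ 4)%N by rewrite expn_gt0 m0.
move: (fft_log F h ^ 4)%N (q ^ fft_log F h)%N m40 hi => m4 G m40 hi.
move: (p * Q)%N (Q * r)%N (p * r)%N (cost P) out inp c0 => x y z c out inp c0.
pose D := (q ^ 2 * m4 * h * c)%N.
have hD : (h * c <= D)%N.
  by rewrite /D -mulnA leq_pmull// muln_gt0 expn_gt0 q0.
have h1 : (12 * q * m4 * G * (x + y + z + c.+1) <= 180 * D)%N.
  apply: (@leq_trans (12 * q * m4 * (3 * q * h) * (5 * c))).
    by apply: leq_mul; [rewrite leq_mul2l hi orbT | lia].
  by apply: eq_leq; rewrite /D; ring.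
have h2 : (z * h <= h * c)%N by rewrite mulnC leq_mul2l out orbT.
have h3 : (0 < h * c)%N by rewrite muln_gt0 h0.
have -> : (725 * q ^ 2 * m4 * h * c = 725 * D)%N by rewrite /D; ring.
lia.
Qed.

(* The query program must be optimal for all exponents at once: it is chosen  *)
(* as a cheapest correct one.                                                  *)
Lemma min_cost_exists I O (ok : slp F I O -> Prop) : (exists P, ok P) ->
  exists P, ok P /\ forall P', ok P' -> (cost P <= cost P')%N.
Proof.
move=> [P0 ok0].
have ex : exists c, `[< exists P, ok P /\ cost P = c >].
  by exists (cost P0); apply/asboolP; exists P0.
case: (ex_minnP ex) => c /asboolP[P [okP <-]] cmin.
exists P; split=> // P' okP'.
by apply: cmin; apply/asboolP; exists P'.
Qed.

Lemma min_query_exists n (S T : {set 'I_n.+1}) h :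
  exists P : slp F 'I_#|prep_index n| ('I_n.+1 * 'I_n.+1 * nat),
    ((1 <= h <= n.+1)%N -> query_correct S T h P) /\
    forall P' : slp F 'I_#|prep_index n| ('I_n.+1 * 'I_n.+1 * nat),
      query_correct S T h P' -> (cost P <= cost P')%N.
Proof.
have [hn|hn] := boolP (1 <= h <= n.+1)%N.
  have [P P_mul] := mulmx_slp_exists F #|S| n.+1 #|T|.
  have [|P' [ok _]] := query_exists P_mul hn.
    by case/andP: hn => h0 _; rewrite mulnAC leq_pmull// muln_gt0.
  by have [P1 [ok1 min1]] := min_cost_exists (ex_intro _ P' ok); exists P1.
exists (Slp [::] (fun=> inr 0%N)); split=> //.
Qed.
End QueryCost.

Section Asymptotics.
Variable R : realType.

Lemma floor_pow_gt0 N (a : R) : (0 < N)%N -> 0 <= a -> (0 < floor_pow N a)%N.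
Proof.
move=> N0 a0; rewrite /floor_pow truncn_gt0 -[leLHS](powRr0 N%:R).
by apply: ler_powR => //; rewrite ler1n.
Qed.

Lemma floor_pow_le N (a : R) : (floor_pow N a)%:R <= N%:R `^ a :> R.
Proof. by rewrite /floor_pow truncn_le powR_ge0. Qed.

Lemma le_floor_pow N (a : R) : (0 < N)%N -> 0 <= a ->
  N%:R `^ a <= 2 * (floor_pow N a)%:R.
Proof.
move=> N0 a0; have := floor_pow_gt0 N0 a0; rewrite -(ler1n R) => f1.
have /andP[_ /ltW] := truncn_itv (powR_ge0 (N%:R : R) a).
by rewrite -[Num.trunc _]/(floor_pow N a) -natr1; lra.
Qed.

Lemma floor_pow_leq N (a : R) : (0 < N)%N -> a <= 1 -> (floor_pow N a <= N)%N.
Proof.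
move=> N0 a1; rewrite -(ler_nat R); apply: le_trans (floor_pow_le _ _) _.
by apply: ler1_powR => //; rewrite ler1n.
Qed.

Lemma floor_pow_mul N (a : R) : (0 < N)%N -> 0 <= a <= 1 ->
  (N <= 4 * floor_pow N (1 - a) * floor_pow N a)%N.
Proof.
move=> N0 /andP[a0 a1]; rewrite -(ler_nat R) !natrM.
have Npos : (0 : R) < N%:R by rewrite ltr0n.
have e : (N%:R : R) = N%:R `^ (1 - a) * N%:R `^ a.
  by rewrite -powRD ?subrK ?powRr1 ?ltW// (gt_eqF Npos) implybT.
rewrite [leLHS]e; have le1 : N%:R `^ (1 - a) <= 2 * (floor_pow N (1 - a))%:R :> R.
  by apply: le_floor_pow => //; rewrite subr_ge0.
have le2 := le_floor_pow N0 a0.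
apply: le_trans (ler_pM (powR_ge0 _ _) (powR_ge0 _ _) le1 le2) _.
by rewrite le_eqVlt; apply/orP; left; apply/eqP; ring.
Qed.

Lemma fft_log_ln (F : finFieldType) :
  exists2 k : R, 0 < k & forall N, (3 <= N)%N -> (fft_log F N)%:R <= k * ln N%:R.
Proof.
have ln2 : (0 : R) < ln 2 by rewrite ln_gt0// ltr1n.
exists (3 / ln 2); first by rewrite divr_gt0.
move=> N N3; have N0 : (0 < N)%N by apply: leq_trans N3.
have q1 : (1 < #|F|)%N := finNzRing_gt1 F.
have [l0 _ _] := fft_log_bounds F N0.
have Npos : (0 : R) < N%:R by rewrite ltr0n.
have h : (2 ^ (fft_log F N).-1 <= N ^ 2)%N.
  apply: (@leq_trans (#|F| ^ (fft_log F N).-1)).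
    by case: (_.-1) => // e; rewrite leq_exp2r.
  apply: (@leq_trans (3 * N)); last by rewrite -mulnn leq_mul2r N3 orbT.
  have N31 : (1 < 3 * N)%N by lia.
  by have /andP[lo _] := up_log_bounds q1 N31; apply: ltnW.
have : ln ((2 ^ (fft_log F N).-1)%:R : R) <= ln ((N ^ 2)%:R : R).
  by rewrite ler_ln ?ler_nat// posrE ltr0n expn_gt0 ?N0.
rewrite !natrX !lnXn ?ltr0n// -[leLHS]mulr_natr -[leRHS]mulr_natr => hl.
have lnN : ln 2 <= ln (N%:R : R).
  by rewrite ler_ln ?posrE ?ltr0n// ler_nat ltnW.
rewrite mulrAC ler_pdivlMr// -(prednK l0) -natr1 mulrDl mul1r.
by move: hl; rewrite [ln 2 * _]mulrC; lra.
Qed.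

Lemma bigO_nat (f g : nat -> R) (k : R) n0 : 0 < k ->
  (forall n, (n0 <= n)%N -> `|f n| <= k * `|g n|) -> f =O_\oo g.
Proof.
move=> k0 fg; apply/eqO_exP; exists k => //.
near=> n; apply: fg; near: n; exact: nbhs_infty_ge.
Unshelve. all: by end_near. Qed.

Lemma nat_bigO (f g : nat -> R) : f =O_\oo g ->
  exists k n0, 0 < k /\ forall n, (n0 <= n)%N -> `|f n| <= k * `|g n|.
Proof.
by move=> /eqO_exP[k k0 [n0 _ fg]]; exists k, n0.
Qed.
End Asymptotics.

(* The matrices have size n.+1. *)
Theorem theorem1 (R : realType) (F : finFieldType) :
  exists (m : nat -> nat)
    (prep : forall n : nat, slp F (FNF_index n) 'I_(m n))
    (query : forall (n : nat) (S T : {set 'I_n.+1}) (h : nat),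
       slp F 'I_(m n) ('I_n.+1 * 'I_n.+1 * nat)),
  [/\ (* correctness *)
      forall (n : nat) (A U C V : 'M[F]_n.+1) (S T : {set 'I_n.+1}) (h : nat),
        generic A -> is_FNF A U C V -> (1 <= h <= n.+1)%N ->
        forall (i j : 'I_n.+1) (k : nat),
          i \in S -> j \in T -> (1 <= k <= h)%N ->
          run (run (FNF_data A U C V) (prep n)) (query n S T h) (i, j, k)
          = (A ^+ k) i j,
      (* preprocessing time *)
      exists2 tau : nat -> R,
        soft_O tau (fun N => N%:R ^+ 2)
        & forall n : nat, (cost (prep n))%:R <= tau n.+1
    & (* query time *)
      forall s t alpha w : R,
        0 <= s <= 1 -> 0 <= t <= 1 -> 0 <= alpha <= 1 ->
        mulmx_exponent F s (1 - alpha) t w ->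
        exists2 tau : nat -> R,
          soft_O tau (fun N => N%:R `^ (w + alpha))
          & forall (n : nat) (S T : {set 'I_n.+1}) (h : nat),
              #|S| = floor_pow n.+1 s -> #|T| = floor_pow n.+1 t ->
              h = floor_pow n.+1 alpha ->
              (cost (query n S T h))%:R <= tau n.+1].
Proof.
pose prep n := sval (cid (prep_exists F n)).
pose query n S T h := sval (cid (@min_query_exists F n S T h)).
exists (fun n => #|prep_index n|), prep, query.
have [k k0 kP] := @fft_log_ln R F.
have ln_ge0 N : 0 <= ln (N.+1%:R : R) by rewrite ln_ge0// ler1n.
have log4 N : (3 <= N.+1)%N ->
    (fft_log F N.+1 ^ 4)%:R <= k ^+ 4 * ln N.+1%:R ^+ 4.
  move=> N3; rewrite natrX -exprMn lerXn2r ?nnegrE ?kP//.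
  by rewrite mulr_ge0 ?ln_ge0// ltW.
have q0 : (0 < #|F|)%N := ltnW (finNzRing_gt1 F).
split.
- move=> n A U C V S T h _ fnf hn i j l iS jT lh.
  have [_ runP] := svalP (cid (prep_exists F n)).
  have [ok _] := svalP (cid (@min_query_exists F n S T h)).
  rewrite -(ok hn A U C V fnf i j l iS jT lh); congr (run _ _ _).
  by apply/funext => u; apply: runP.
- have [c c0 cE] : exists2 c, (0 < c)%N &
      forall n, prep_cost F n = (c * fft_log F n.+1 ^ 4 * n.+1 ^ 2)%N.
    by exists (400 * #|F| ^ 2)%N; rewrite // muln_gt0 expn_gt0 q0.
  exists (fun N => (c * fft_log F N ^ 4 * N ^ 2)%:R); last first.
    by move=> n; have [cP _] := svalP (cid (prep_exists F n)); rewrite -cE ler_nat.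
  exists 4%N; apply: (@bigO_nat _ _ _ (c%:R * k ^+ 4) 3).
    by rewrite mulr_gt0 ?exprn_gt0 ?ltr0n.
  move=> [//|N] N3; rewrite ger0_norm ?ler0n// ger0_norm; last first.
    by rewrite mulr_ge0 ?exprn_ge0.
  rewrite natrM (natrM _ c).
  rewrite [leRHS](_ : _ = c%:R * (k ^+ 4 * ln N.+1%:R ^+ 4) *
    (N.+1 ^ 2)%:R); last by rewrite [(N.+1 ^ 2)%:R]natrX; ring.
  by rewrite ler_wpM2r// ler_wpM2l// log4.
- move=> s t alpha w /andP[s0 s1] /andP[t0 t1] /andP[a0 a1] [M [M_mul M_O]].
  have [c c0 cE] : exists2 c, (0 < c)%N &
      forall h, query_factor F h = (c * fft_log F h ^ 4)%N.
    by exists (725 * #|F| ^ 2)%N; rewrite // muln_gt0 expn_gt0 q0.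
  have [kM [nM [kM0 MP]]] := nat_bigO M_O.
  exists (fun N => (c * fft_log F N ^ 4)%:R * N%:R `^ alpha *
    (cost (M N))%:R).
    exists 4%N; apply: (@bigO_nat _ _ _ (c%:R * k ^+ 4 * kM)
      (maxn 3 nM)).
      by rewrite !mulr_gt0 ?exprn_gt0 ?ltr0n.
    move=> [|N]; first by rewrite geq_max.
    rewrite geq_max => /andP[N3 NM].
    rewrite ger0_norm ?mulr_ge0 ?powR_ge0//.
    rewrite ger0_norm ?mulr_ge0 ?powR_ge0 ?exprn_ge0//.
    have := MP _ NM; rewrite ger0_norm// ger0_norm ?powR_ge0// => cM.
    rewrite [leRHS](_ : _ = c%:R * (k ^+ 4 * ln N.+1%:R ^+ 4) *
      N.+1%:R `^ alpha * (kM * N.+1%:R `^ w)); last first.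
      rewrite powRD; first by ring.
      by rewrite pnatr_eq0 implybT.
    rewrite (natrM _ c) ler_pM ?mulr_ge0 ?powR_ge0//.
    by rewrite ler_wpM2r ?powR_ge0// ler_wpM2l// log4.
  move=> n S T h cS cT hE.
  have h0 : (0 < h)%N by rewrite hE floor_pow_gt0.
  have hn : (h <= n.+1)%N by rewrite hE floor_pow_leq.
  have [_ qmin] := svalP (cid (@min_query_exists F n S T h)).
  have hQ : (n.+1 <= 4 * floor_pow n.+1 (1 - alpha) * h)%N.
    by rewrite hE floor_pow_mul// a0.
  have Q0 : (0 < floor_pow n.+1 (1 - alpha))%N by rewrite floor_pow_gt0// subr_ge0.
  have p0 : (0 < floor_pow n.+1 s)%N by rewrite floor_pow_gt0.
  have r0 : (0 < floor_pow n.+1 t)%N by rewrite floor_pow_gt0.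
  have [P' [okP' cP']] : exists P' :
      slp F 'I_#|prep_index n| ('I_n.+1 * 'I_n.+1 * nat),
      query_correct S T h P' /\
      (cost P' <= query_factor F h * h * cost (M n.+1))%N.
    move: (M n.+1) (M_mul n.+1) p0 r0; rewrite -cS -cT => Mn Mn_mul p0 r0.
    have [|P' [ok cP']] := @query_exists F n S T h _ Mn Mn_mul _ hQ.
      by rewrite h0.
    exists P'; split=> //.
    exact: leq_trans cP' (query_cost_bound p0 Q0 r0 h0 Mn_mul).
  apply: (@le_trans _ _ (query_factor F h * h * cost (M n.+1))%:R).
    by rewrite ler_nat (leq_trans (qmin _ okP')).
  rewrite cE natrM [X in X * _]natrM ler_wpM2r// ler_pM//.
    by rewrite ler_nat leq_mul2l leq_exp2r// leq_up_log ?leq_mul2l ?hn ?orbT.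
  by rewrite hE floor_pow_le.
Qed.
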